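(* Consider the nonstandard renewal risk model in Case 2 (described in the context). Let $Y_i$, $i\ge1$, be ENOD random variables with common distribution $G\in\mathcal C$ and dominating coefficient $M_G$, and let $Z_i$, $i\ge1$, be ENOD random variables with common distribution $H$ satisfying $\overline H(x)=o(\overline G(x))$ as $x\to\infty$ and dominating coefficient $M_H$. Then for each pair $\max\{\mu_G,\mu_H^{-1}\mu_G\}<\gamma<\Gamma<\infty$, $$1\le\liminf_{t\to\infty}\inf_{x\in[\gamma t,\Gamma t]}\frac{\psi(x;t)}{\mu_H^{-1}t\,\overline{G}(x-\mu_{G}\mu_H^{-1}t+ct)}\le\limsup_{t\to\infty}\sup_{x\in[\gamma t,\Gamma t]}\frac{\psi(x;t)}{\mu_H^{-1}t\,\overline{G}(x-\mu_{G}\mu_H^{-1}t+ct)}\le d^{-1},$$ where $d=\overline{G_*}\Big(1+\frac{c}{\gamma-\mu_H^{-1}\mu_G}\Big)$.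
   Context: Notation: for a distribution $F$, $\overline F=1-F$ is its tail, and for $y\in(0,\infty)$, $\overline{F_*}(y)=\liminf_{x\to\infty}\overline F(xy)/\overline F(x)$. The class $\mathcal C$ (consistently varying tails) consists of the distributions $F$ with $\lim_{y\downarrow 1}\overline{F_*}(y)=1$. Dependence: random variables $X_i$, $i\ge1$, are ENOD (extended negatively orthant dependent) with dominating coefficient $M>0$ if for all $n\ge 1$ and all real $x_1,\dots,x_n$, both $P(\bigcap_{i=1}^n\{X_i>x_i\})\le M\prod_{i=1}^nP(X_i>x_i)$ and $P(\bigcap_{i=1}^n\{X_i\le x_i\})\le M\prod_{i=1}^nP(X_i\le x_i)$. Renewal risk model: claim sizes $Y_i$, $i\ge1$, are random variables with common distribution $G$ on $[0,\infty)$ and mean $0<\mu_G<\infty$; inter-arrival times $Z_i$, $i\ge1$, are random variables with common distribution $H$ on $[0,\infty)$ and mean $0<\mu_H<\infty$; $\tau$ is a nonnegative random variable (random time). $N(t)=\sum_{n\ge1}\mathbf 1_{\{Z_1+\cdots+Z_n\le t\}}$, $\lambda(t)=EN(t)$, with $\inf\{t:0<\lambda(t)<\infty\}=0$. The positive constant $c$ satisfies the safety loading condition $\mu_G<c\mu_H$. The finite-time ruin probability is $\psi(x;t)=P\big(\max_{0\le n\le N(t)}\sum_{i=1}^n(Y_i-cZ_i)>x\big)$, $x\ge0$, $t\ge0$ (empty sum $=0$). Case 2 of the nonstandard model: $\{(Y_i,Z_i),i\ge1\}$ and $\tau$ are independent of each other, but the sequences $\{Y_i,i\ge1\}$ and $\{Z_i,i\ge1\}$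 are allowed to be arbitrarily dependent on each other. *)

(* Defs.v *)
From mathcomp Require Import all_boot all_order all_algebra.
From mathcomp Require Import all_classical all_reals all_analysis.
Set Implicit Arguments.
Unset Strict Implicit.
Unset Printing Implicit Defensive.
Import Order.TTheory GRing.Theory Num.Theory.
Import numFieldNormedType.Exports.
Local Open Scope classical_set_scope.
Local Open Scope ring_scope.

Section distributions.
Context {R : realType}.
Implicit Types F : probability R R.

(* The codomain is R^o so that tails can be compared with the Landau
   notations. *)
Definition tail F (x : R) : R^o := fine (F `]x, +oo[%classic).

(* If the tail of F vanishes near +oo, the quotient is 0 there because
   division by 0 gives 0; so such an F is not in [consistently_varying]. *)
Definition tail_liminf F (y : R) : \bar R :=
  limf_einf (fun x : R => (tail F (x * y) / tail F x)%:E) +oo%R.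

Definition consistently_varying F : Prop :=
  tail_liminf F y @[y --> 1^'+] --> 1%E.

Definition nonneg_law F : Prop := F `]-oo, 0[%classic = 0%E.

Definition has_mean F (m : R) : Prop :=
  F.-integrable setT EFin /\ (\int[F]_x x%:E)%E = m%:E.

(* The filter of neighborhoods of +oo, bundled for the Landau notations. *)
Definition pinfty_filter : filter_on R := FilterType (+oo_R) _.

End distributions.

Section random_variables.
Context {d : measure_display} {T : measurableType d} {R : realType}.
Variable P : probability T R.

Definition has_law (X : {RV P >-> R}) (F : probability R R) : Prop :=
  forall A, measurable A -> distribution P X A = F A.

(* Sequences (X_i), i >= 1, are indexed from 0: X_i is [X i.-1]. *)
Definition enod (X : nat -> {RV P >-> R}) (M : R) : Prop :=
  0 < M /\
  forall (n : nat) (x : 'I_n -> R), (1 <= n)%N ->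
    (P [set w | forall i : 'I_n, (x i < X i w)%R] <=
       M%:E * \prod_(i < n) P [set w | (x i < X i w)%R])%E /\
    (P [set w | forall i : 'I_n, (X i w <= x i)%R] <=
       M%:E * \prod_(i < n) P [set w | (X i w <= x i)%R])%E.

Definition sigma_pairs (Y Z : nat -> {RV P >-> R}) : set (set T) :=
  <<s [set A | exists i B, measurable B /\
                 (A = Y i @^-1` B \/ A = Z i @^-1` B)] >>.

Definition independent_of_pairs (Y Z : nat -> {RV P >-> R})
    (tau : {RV P >-> R}) : Prop :=
  forall A B, sigma_pairs Y Z A -> measurable B ->
    P (A `&` tau @^-1` B) = (P A * P (tau @^-1` B))%E.

End random_variables.

Section renewal_risk_model.
Context {d : measure_display} {T : measurableType d} {R : realType}.
Variable P : probability T R.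
Variables (Y Z : nat -> {RV P >-> R}) (c : R).

(* N(t) may be infinite at some outcomes, hence takes values in \bar R. *)
Definition renewal_count (t : R) (w : T) : \bar R :=
  (\sum_(1 <= n <oo) (\1_[set v | (\sum_(i < n) Z i v <= t)%R] w)%:E)%E.

Definition renewal_fun (t : R) : \bar R := (\int[P]_w renewal_count t w)%E.

Definition claim_surplus (n : nat) (w : T) : R :=
  \sum_(i < n) (Y i w - c * Z i w).

(* The supremum is the maximum over 0 <= n <= N(t) whenever N(t) is finite. *)
Definition max_claim_surplus (t : R) (w : T) : \bar R :=
  ereal_sup [set (claim_surplus n w)%:E | n in
               [set n : nat | (n%:R%:E <= renewal_count t w)%E]].

Definition ruin_prob (x t : R) : R :=
  fine (P [set w | (x%:E < max_claim_surplus t w)%E]).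

End renewal_risk_model.

(* Main.v *)
Require Import Defs.
From mathcomp Require Import all_boot all_order all_algebra.
From mathcomp Require Import all_classical all_reals all_analysis.
From mathcomp Require Import measurable_realfun ring lra zify.
Set Implicit Arguments.
Unset Strict Implicit.
Unset Printing Implicit Defensive.
Import Order.TTheory GRing.Theory Num.Theory.
Import numFieldNormedType.Exports.
Local Open Scope classical_set_scope.
Local Open Scope ring_scope.

(** Ruin before time [t] is compared with sums that have a fixed number [n] of
terms. Whatever [n] is, ruin forces the [n]-th arrival to come by time [t] or the
first [n] claims to exceed [x] ([ruin_prob_le]); conversely, if the first [n]
claims exceed [x + c * t] and the [n]-th arrival comes by time [t], ruin has
occurred ([ruin_prob_ge]). These are inclusions of events, valid under any
dependence between claims and arrival times; the price is the gap of [c * t]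
between the two levels, which the factor [d^-1] of the upper bound accounts for.
Taking [n] slightly above, resp. slightly below, [t / muH] makes the event on the
arrival times improbable, and consistent variation absorbs both the relative error
on [n] and the shift of the level that it causes.

What remains is a precise large deviation estimate for sums of extended negatively
dependent variables: up to negligible errors, [P (Y_1 + ... + Y_n > n * mu + x)]
is between [n * tail (x + n * eps)] and [n * tail (x - n * eps)]
([sum_gt_lower], [sum_gt_upper]). The sum is large because one term is large. Two
large terms have probability [O ((n * tail n) ^ 2)], and [n * tail n] tends to [0]
because the mean is finite. A negligible error is one that is [o (n * tail n)],
where the tail is that of the claims ([negligible_to]).

The remaining terms must be shown not to contribute. Their lower deviations are
exponentially small ([pr_count_le]). For the upper deviations the terms are
truncated at [n * eta], and Chernoff's inequality is applied with a parameter
adapted to the tail ([truncated_sum_le]); no moment of order above [1] is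
available, and the doubling property of the tail replaces it. The same estimate
serves for the arrival times, whose tail is dominated by that of the claims.

Extended negative dependence bounds the probability of orthants. To get from there
to exponential moments, [exp (theta * X)] is replaced by a step function of [X], a
combination of indicators of half-lines: a product of such functions expands into
a finite sum of indicators of orthants ([markov_prod]). *)

(** * Consistently varying functions *)

Section consistent_variation.
Context {R : realType}.
Implicit Types g : R -> R.

(** Consistent variation without quotients. Positivity has to be part of it: the
inequality alone holds for a [g] that vanishes near infinity. *)
Definition consistent g := forall eps : R, 0 < eps ->
  exists y x0 : R, [/\ 1 < y, 0 < x0 &
    forall x, x0 <= x -> 0 < g x /\ g x <= (1 + eps) * g (x * y)].

Lemma consistent_gt0 g : {homo g : x y /~ x <= y} -> consistent g ->
  forall x, 0 < g x.
Proof.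
move=> gd gC x; have [y [x0 [_ _ h]]] := gC 1 ltr01.
have [+ _] := h (Num.max x x0) ltac:(by rewrite le_max lexx orbT).
by move=> /lt_le_trans; apply; apply: gd; rewrite le_max lexx.
Qed.

Lemma consistent_double g : consistent g ->
  exists y x0 : R, [/\ 1 < y, 0 < x0 &
    forall x, x0 <= x -> g x <= 2 * g (x * y)].
Proof.
move=> gC; have [y [x0 [y1 x00 h]]] := gC 1 ltr01.
by exists y, x0; split => // x /h[].
Qed.

Section doubling.
Variables (g : R -> R) (y x0 : R).
Hypotheses (gd : {homo g : x y /~ x <= y}) (g0 : forall x, 0 < g x).
Hypotheses (y1 : 1 < y) (x00 : 0 < x0).
Hypothesis gy : forall x, x0 <= x -> g x <= 2 * g (x * y).

Lemma doubling_up k x : x0 <= x -> g x <= 2 ^+ k * g (x * y ^+ k).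
Proof.
move=> x0x; elim: k => [|k IH]; first by rewrite !expr0 mul1r mulr1.
apply: (le_trans IH); rewrite exprSr -mulrA ler_pM2l ?exprn_gt0//.
rewrite exprSr mulrA; apply: gy; apply: (le_trans x0x).
by rewrite ler_peMr ?(le_trans (ltW x00) x0x)// exprn_ege1// ltW.
Qed.

(** Going down from [V] by factors of [y], either [k] steps stay above [x0], or
[g V] is already bounded from below by a fixed multiple of [2 ^- k]. *)
Lemma doubling_down k V : x0 <= V ->
  (x0 <= V / y ^+ k /\ g (V / y ^+ k) <= 2 ^+ k * g V)
  \/ g (x0 * y) <= 2 ^+ k * g V.
Proof.
move=> x0V; have y0 : 0 < y by rewrite (lt_trans _ y1).
elim: k => [|k [[h1 h2]|h]].
- by left; rewrite !expr0 divr1 mul1r.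
- have Vk : V / y ^+ k = V / y ^+ k.+1 * y.
    by rewrite exprSr invfM mulrA mulrVK// unitfE gt_eqF.
  have [h3|h3] := lerP x0 (V / y ^+ k.+1).
    left; split => //; apply: (le_trans (gy h3)).
    by rewrite -Vk exprS -mulrA ler_pM2l.
  right; apply: (@le_trans _ _ (g (V / y ^+ k))).
    by apply: gd; rewrite Vk ler_wpM2r// ltW.
  apply: (le_trans h2); rewrite ler_pM2r// exprS ler_peMl// ?exprn_ge0//.
  lra.
- right; apply: (le_trans h); rewrite ler_pM2r// exprS ler_peMl ?exprn_ge0//.
  lra.
Qed.

End doubling.

Lemma exists_expr_ge (y A : R) : 1 < y -> exists k, A <= y ^+ k.
Proof.
move=> y1; exists (Num.trunc (A / (y - 1))).+1.
set k := Num.trunc _.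
have -> : y = 1 + (y - 1) by rewrite addrC subrK.
have := truncnS_gt (A / (y - 1)); rewrite -/k ltr_pdivrMr ?subr_gt0// => Ak.
have y10 : 0 < y - 1 by rewrite subr_gt0.
have bern : forall n, 1 + n%:R * (y - 1) <= (1 + (y - 1)) ^+ n.
  elim=> [|n IH]; first by rewrite mul0r addr0 expr0.
  rewrite exprS; apply: (@le_trans _ _ ((1 + (y - 1)) * (1 + n%:R * (y - 1)))).
    rewrite -natr1.
    have : 0 <= n%:R * ((y - 1) * (y - 1)) by rewrite mulr_ge0// mulr_ge0// ltW.
    lra.
  by rewrite ler_pM2l//; lra.
by apply: le_trans (bern _); lra.
Qed.

(** Finitely many steps of ratio [y] lead from [a * t] to [b * t], each at the cost
of a factor [2]. *)
Lemma consistent_comparable g : {homo g : x y /~ x <= y} -> consistent g ->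
  forall a b : R, 0 < a -> 0 < b ->
  exists C t0 : R, [/\ 0 < C, 0 < t0 & forall t, t0 <= t -> g (a * t) <= C * g (b * t)].
Proof.
move=> gd gC a b a0 b0; have g0 := consistent_gt0 gd gC.
have [y [x0 [y1 x00 h]]] := consistent_double gC.
have [k hk] := exists_expr_ge (b / a) y1.
exists (2 ^+ k), (x0 / a); split; rewrite ?exprn_gt0 ?divr_gt0// => t.
rewrite ler_pdivrMr// => x0t.
apply: (le_trans (doubling_up y1 x00 h k _)); first by rewrite mulrC.
rewrite ler_pM2l ?exprn_gt0//; apply: gd.
have t0 : 0 < t by rewrite -(pmulr_lgt0 _ a0) (lt_le_trans x00).
rewrite -mulrA [t * _]mulrC mulrA ler_pM2r// mulrC.
by rewrite -ler_pdivrMr.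
Qed.

(** Consistent variation forces [g n.+1 / g n] to tend to [1], so that [g] decreases
more slowly than any geometric sequence. *)
Lemma consistent_expr g : {homo g : x y /~ x <= y} -> consistent g ->
  forall rho eps : R, 0 < rho < 1 -> 0 < eps ->
  \forall n \near \oo, rho ^+ n <= eps * g n%:R.
Proof.
move=> gd gC rho eps /andP[r0 r1] e0; have g0 := consistent_gt0 gd gC.
(* any dl with (1 + dl) * rho < 1 would do *)
pose dl : R := (rho^-1 - 1) / 2.
have ri : 1 < rho^-1 by rewrite invf_gt1.
have dl0 : 0 < dl by rewrite /dl; lra.
have [y [x0 [y1 x00 h]]] := gC _ dl0.
pose n1 := (Num.trunc (Num.max x0 (y - 1)^-1)).+1.
have n1gt : Num.max x0 (y - 1)^-1 < n1%:R by exact: truncnS_gt.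
have [n1x0 n1y] : x0 < n1%:R /\ (y - 1)^-1 < n1%:R.
  by move: n1gt; rewrite gt_max => /andP[].
have step m : g n1%:R <= (1 + dl) ^+ m * g (n1 + m)%:R.
  elim: m => [|m IH]; first by rewrite expr0 mul1r addn0.
  apply: (le_trans IH); rewrite exprSr -mulrA ler_pM2l ?exprn_gt0//; last lra.
  have n1m : n1%:R <= (n1 + m)%:R :> R by rewrite ler_nat leq_addr.
  have [_ /le_trans] := h _ (le_trans (ltW n1x0) n1m); apply.
  rewrite ler_pM2l; last by lra.
  apply: gd; rewrite addnS -natr1.
  suff : 1 <= (n1 + m)%:R * (y - 1) by lra.
  rewrite -ler_pdivrMr; last by lra.
  by rewrite div1r (le_trans (ltW n1y)).
pose s := (1 + dl) * rho.
have s1 : s < 1.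
  rewrite /s /dl -ltr_pdivlMr// div1r; lra.
have s0 : 0 < s by rewrite mulr_gt0//; lra.
have sn : `|s| < 1 by rewrite gtr0_norm.
have C0 : 0 < eps * g n1%:R * (1 + dl) ^+ n1 by rewrite !mulr_gt0// exprn_gt0//; lra.
have /cvgrPdist_lt/(_ _ C0) sC := cvg_expr sn.
near=> n.
have n1n : (n1 <= n)%N by near: n; exact: nbhs_infty_ge.
have : `|0 - s ^+ n| < eps * g n1%:R * (1 + dl) ^+ n1 by near: n; exact: sC.
rewrite sub0r normrN ger0_norm ?exprn_ge0 ?(ltW s0)// => hn.
have := step (n - n1)%N; rewrite subnKC// => st.
have dn k : 0 < (1 + dl) ^+ k by rewrite exprn_gt0//; lra.
rewrite -(ler_pM2l (dn n)) -exprMn; apply: (le_trans (ltW hn)).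
rewrite -mulrA [leRHS]mulrCA ler_pM2l//.
have -> : (1 + dl) ^+ n = (1 + dl) ^+ n1 * (1 + dl) ^+ (n - n1).
  by rewrite -exprD subnKC.
by rewrite mulrC -mulrA ler_pM2l.
Unshelve. all: by end_near. Qed.

End consistent_variation.

(** * Real-valued probabilities *)

Section real_probability.
Context {d : measure_display} {T : measurableType d} {R : realType}.
Variable P : probability T R.
Implicit Types A B C : set T.

Definition pr A : R := fine (P A).

Lemma prE A : measurable A -> P A = (pr A)%:E.
Proof. by move=> mA; rewrite /pr fineK// fin_num_measure. Qed.

Lemma pr_ge0 A : 0 <= pr A.
Proof. by rewrite fine_ge0. Qed.

Lemma pr_le1 A : measurable A -> pr A <= 1.
Proof. by move=> mA; rewrite -lee_fin -prE// probability_le1. Qed.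

Lemma le_pr A B : measurable A -> measurable B -> A `<=` B -> pr A <= pr B.
Proof.
by move=> mA mB AB; rewrite -lee_fin -!prE// le_measure// inE.
Qed.

Lemma prU_le A B : measurable A -> measurable B -> pr (A `|` B) <= pr A + pr B.
Proof.
move=> mA mB; rewrite -lee_fin EFinD -!prE//; last exact: measurableU.
exact: measureU2.
Qed.

Lemma pr_disjU A B : measurable A -> measurable B -> [disjoint A & B] ->
  pr (A `|` B) = pr A + pr B.
Proof.
move=> mA mB /disj_set2P AB; apply: EFin_inj.
by rewrite EFinD -!prE ?measureU//; exact: measurableU.
Qed.

Lemma pr_setC A : measurable A -> pr (~` A) = 1 - pr A.
Proof.
move=> mA; apply: EFin_inj; rewrite EFinB -!prE//; last exact: measurableC.
exact: probability_setC.
Qed.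

Lemma measurable_exists_lt n (A : nat -> set T) : (forall i, measurable (A i)) ->
  measurable [set w | exists2 i, (i < n)%N & A i w].
Proof.
move=> mA; rewrite [X in measurable X](_ : _ = \bigcup_(i < n) A i).
  exact: bigcup_measurable.
by apply/seteqP; split => w [i]; exists i.
Qed.

Lemma measurable_exists (Q : nat -> set T) : (forall i, measurable (Q i)) ->
  measurable [set w | exists i, Q i w].
Proof.
move=> mA; rewrite [X in measurable X](_ : _ = \bigcup_i Q i).
  exact: bigcup_measurable.
by apply/seteqP; split => w [i]; exists i.
Qed.

Lemma pr_exists_le n (A : nat -> set T) : (forall i, measurable (A i)) ->
  pr [set w | exists2 i, (i < n)%N & A i w] <= \sum_(i < n) pr (A i).
Proof.
move=> mA; elim: n => [|n IH].
  rewrite big_ord0 [X in pr X](_ : _ = set0) ?/pr ?measure0//.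
  by apply/seteqP; split => w [].
rewrite big_ord_recr/=.
apply: (@le_trans _ _ (pr ([set w | exists2 i, (i < n)%N & A i w] `|` A n))).
  apply: le_pr; [exact: measurable_exists_lt| |].
    by apply: measurableU => //; exact: measurable_exists_lt.
  move=> w [i]; rewrite ltnS leq_eqVlt => /predU1P[->|ilt] Aiw; first by right.
  by left; exists i.
apply: (le_trans (prU_le _ _)) => //; first exact: measurable_exists_lt.
by rewrite lerD2r.
Qed.

(** Lower half of the Bonferroni inequalities, by induction on the number of
events: adding [A n] loses at most the [n] pairs that involve it. *)
Lemma pr_exists_ge n (A : nat -> set T) (p q : R) :
  (forall i, measurable (A i)) -> (forall i, pr (A i) = p) ->
  (forall i j, i != j -> pr (A i `&` A j) <= q) ->
  n%:R * p - n%:R ^+ 2 * q <= pr [set w | exists2 i, (i < n)%N & A i w].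
Proof.
move=> mA Ap Aq; elim: n => [|n IH].
  by rewrite expr0n/= !mul0r subr0 pr_ge0.
have q0 : 0 <= q by apply: le_trans (Aq 0%N 1%N isT); exact: pr_ge0.
pose U := [set w | exists2 i, (i < n)%N & A i w].
have mU : measurable U by exact: measurable_exists_lt.
have UA : pr (A n `&` U) <= n%:R * q.
  apply: (@le_trans _ _ (pr [set w | exists2 i, (i < n)%N & (A i `&` A n) w])).
    apply: le_pr; [exact: measurableI| |].
      by apply: measurable_exists_lt => i; exact: measurableI.
    by move=> w [Anw [i ilt Aiw]]; exists i.
  apply: (le_trans (pr_exists_le _ _)); first by move=> i; exact: measurableI.
  apply: (@le_trans _ _ (\sum_(i < n) q)).
    by apply: ler_sum => i _; apply: Aq; rewrite neq_ltn ltn_ord.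
  by rewrite sumr_const card_ord mulr_natl.
have An : pr (A n) <= pr (A n `\` U) + pr (A n `&` U).
  apply: (@le_trans _ _ (pr ((A n `\` U) `|` (A n `&` U)))).
    apply: le_pr => //.
      by apply: measurableU; [exact: measurableD|exact: measurableI].
    by move=> w Anw; have [Uw|nUw] := pselect (U w); [right|left].
  by apply: prU_le; [exact: measurableD|exact: measurableI].
have UD : pr U + pr (A n `\` U) <=
    pr [set w | exists2 i, (i < n.+1)%N & A i w].
  rewrite -pr_disjU//; last 2 first.
  - exact: measurableD.
  - by apply/disj_set2P/seteqP; split => w // [Uw [_]].
  apply: le_pr; [by apply: measurableU => //; exact: measurableD
    |exact: measurable_exists_lt|].
  move=> w [[i ilt Aiw]|[Anw _]]; first by exists i => //; exact: ltnW.
  by exists n.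
rewrite -[in leLHS]natr1.
have n0 : 0 <= n%:R :> R by [].
have nq : 0 <= n%:R * q by rewrite mulr_ge0.
have := Ap n; move: IH; rewrite -/U; move: UD An UA.
move: (pr U) (pr (A n)) (pr (_ `\` _)) (pr (_ `&` _)) (pr [set _ | _]).
move=> a b c e f; nra.
Qed.

Lemma measurable_lt_RV (f : T -> R) (a : R) : measurable_fun setT f ->
  measurable [set w | a < f w].
Proof.
move=> mf; have := mf measurableT _ (measurable_itv `]a, +oo[%R).
rewrite setTI; congr measurable; apply/seteqP; split => w /=;
  by rewrite in_itv/= andbT.
Qed.

Lemma measurable_le_RV (f : T -> R) (a : R) : measurable_fun setT f ->
  measurable [set w | f w <= a].
Proof.
move=> mf; have := mf measurableT _ (measurable_itv `]-oo, a]%R).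
by rewrite setTI; congr measurable; apply/seteqP; split => w /=; rewrite in_itv/=.
Qed.

Lemma measurable_gt_RV (f : T -> R) (a : R) : measurable_fun setT f ->
  measurable [set w | f w < a].
Proof.
move=> mf; have := mf measurableT _ (measurable_itv `]-oo, a[%R).
by rewrite setTI; congr measurable; apply/seteqP; split => w /=; rewrite in_itv/=.
Qed.

End real_probability.

(** * Exponential inequalities under extended negative dependence *)

Section step_functions.
Context {d : measure_display} {T : measurableType d} {R : realType}.
Variable P : probability T R.

Lemma integral_step (I : finType) (c : I -> R) (B : I -> set T) :
  (forall i, 0 <= c i) -> (forall i, measurable (B i)) ->
  (\int[P]_w (\sum_i c i * \1_(B i) w)%:E = (\sum_i c i * pr P (B i))%:E)%E.
Proof.
move=> c0 mB; under eq_integral do rewrite -sumEFin.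
rewrite ge0_integral_sum//; last 2 first.
- move=> i; apply/measurable_EFinP; exact: measurable_funM.
- by move=> j w _; rewrite lee_fin mulr_ge0.
rewrite -sumEFin; apply: eq_bigr => i _; under eq_integral do rewrite EFinM.
rewrite ge0_integralZl_EFin//; last first.
  by apply/measurable_EFinP; exact: measurable_indic.
by rewrite integral_indic// setIT EFinM -prE.
Qed.

Lemma le_pr_step (I : finType) (c : I -> R) (B : I -> set T) (s : R) E :
  (forall i, 0 <= c i) -> (forall i, measurable (B i)) -> 0 <= s ->
  measurable E -> (forall w, E w -> s <= \sum_i c i * \1_(B i) w) ->
  s * pr P E <= \sum_i c i * pr P (B i).
Proof.
move=> c0 mB s0 mE sE; rewrite -lee_fin -integral_step//.
have -> : s * pr P E = \sum_(i : 'I_1) s * pr P E by rewrite big_ord1.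
rewrite -(integral_step (B := fun=> E))//; apply: ge0_le_integral => //.
- by move=> w _; rewrite lee_fin big_ord1 mulr_ge0.
- apply/measurable_EFinP; apply: measurable_sum => i.
  exact: measurable_funM.
- apply/measurable_EFinP; apply: measurable_sum => i.
  exact: measurable_funM.
- move=> w _; rewrite lee_fin big_ord1 indicE.
  have [Ew|nEw] := boolP (w \in E); rewrite ?mulr1 ?mulr0.
    by apply: sE; rewrite inE in Ew.
  by apply: sumr_ge0 => i _; rewrite mulr_ge0.
Qed.

Lemma measurable_forall_ord n (A : 'I_n -> set T) : (forall i, measurable (A i)) ->
  measurable [set w | forall i, A i w].
Proof.
move=> mA; rewrite [X in measurable X](_ : _ = \bigcap_(i in setT) A i).
  by apply: fin_bigcap_measurable => //; exact: finite_finset.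
by apply/seteqP; split => w h i; have := h i; [|apply].
Qed.

(** Expanding the product over all choice functions reduces the expectation of a
product of step functions to probabilities of intersections of level sets, the
only joint events on which an assumption is made. *)
Lemma markov_prod n K (A : 'I_n -> 'I_K -> set T) (a p : 'I_K -> R) (M s : R) E :
  (forall i j, measurable (A i j)) -> (forall j, 0 <= a j) ->
  (forall s : {ffun 'I_n -> 'I_K},
    pr P [set w | forall i, A i (s i) w] <= M * \prod_i p (s i)) ->
  0 <= s -> measurable E ->
  (forall w, E w -> s <= \prod_(i < n) \sum_(j < K) a j * \1_(A i j) w) ->
  s * pr P E <= M * (\sum_(j < K) a j * p j) ^+ n.
Proof.
move=> mA a0 hp s0 mE sE.
have prodE (x : 'I_n -> 'I_K -> R) : \prod_(i < n) \sum_(j < K) a j * x i j =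
    \sum_(s : {ffun 'I_n -> 'I_K}) (\prod_i a (s i)) * \prod_i x i (s i).
  by rewrite bigA_distr_bigA/=; apply: eq_bigr => f _; rewrite big_split.
apply: (@le_trans _ _ (\sum_(f : {ffun 'I_n -> 'I_K}) (\prod_i a (f i)) *
    pr P [set w | forall i, A i (f i) w])).
  apply: le_pr_step => // [f|f|w /sE].
  - by rewrite prodr_ge0.
  - exact: measurable_forall_ord.
  move=> /le_trans; apply; rewrite prodE; apply: ler_sum => f _.
  rewrite ler_wpM2l ?prodr_ge0// indicE.
  have [|nB] := boolP (w \in _).
    rewrite inE/= => hB; rewrite big1// => i _; rewrite indicE mem_set//.
  have : ~ [set w0 | forall i, A i (f i) w0] w by move: nB; rewrite notin_setE.
  move=> /= /existsNP[i nA]; rewrite (bigD1 i)//= indicE memNset// mul0r.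
  exact: lexx.
have -> : (\sum_(j < K) a j * p j) ^+ n = \prod_(i < n) \sum_(j < K) a j * p j.
  by rewrite prodr_const card_ord.
rewrite (prodE (fun=> p)) mulr_sumr; apply: ler_sum => f _.
by rewrite mulrCA ler_wpM2l// prodr_ge0.
Qed.

End step_functions.

(** A nonincreasing sequence of booleans consists of ones followed by zeros, hence
any function of their number is an affine combination of them. *)
Lemma abel_count (R : realType) (phi : nat -> R) (b : nat -> bool) N :
  (forall j, b j.+1 -> b j) ->
  phi (\sum_(j < N) b j)%N =
  phi 0%N + \sum_(j < N) (phi j.+1 - phi j) * (b j)%:R.
Proof.
move=> bS; elim: N => [|N IH]; first by rewrite !big_ord0 addr0.
rewrite !big_ord_recr/= addrA -IH.
have [bN|bN] := boolP (b N); last by rewrite addn0 mulr0 addr0.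
suff -> : (\sum_(j < N) b j)%N = N by rewrite addn1 mulr1 addrC subrK.
transitivity (\sum_(j < N) 1)%N; last by rewrite sum1_card card_ord.
suff bj k j : (j + k = N)%N -> b j.
  by apply: eq_bigr => j _; rewrite (bj (N - j)%N)// subnKC// ltnW.
elim: k j => [|k IHk] j; first by rewrite addn0 => ->.
by rewrite addnS -addSn => /IHk/bS.
Qed.

(** [tail] takes values in the regular module [R^o]; computations with its values
are done in [R] itself. *)
Definition survival {R : realType} (F : probability R R) (s : R) : R := tail F s.

Section tails.
Context {R : realType}.
Variable F : probability R R.

Lemma survivalE s : survival F s = pr F `]s, +oo[.
Proof. by []. Qed.

Lemma survival_ge0 s : 0 <= survival F s.
Proof. exact: pr_ge0. Qed.

Lemma survival_le1 s : survival F s <= 1.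
Proof. by rewrite survivalE pr_le1. Qed.

Lemma survival_le : {homo (survival F) : x y /~ x <= y}.
Proof.
move=> x y xy; rewrite !survivalE; apply: le_pr => // z /=.
by rewrite !in_itv/= !andbT; exact: le_lt_trans.
Qed.

Lemma survival_lt0 s : nonneg_law F -> s < 0 -> survival F s = 1.
Proof.
rewrite /nonneg_law => F0 s0; apply/eqP; rewrite eq_le survival_le1/=.
have : pr F (~` `]-oo, 0[) <= survival F s.
  rewrite survivalE; apply: le_pr => //; first exact: measurableC.
  move=> z /=; rewrite !in_itv/= andbT => /negP; rewrite -leNgt.
  exact: lt_le_trans.
by rewrite pr_setC// /pr F0 subr0.
Qed.

End tails.

(** For [a] an arithmetic progression this is, up to scaling, a lattice approximation
of [x] truncated at the end of the progression; contrary to the truncation itself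
it is a step function of [x]. *)
Definition count_above (R : realType) (a : nat -> R) N (x : R) : nat :=
  (\sum_(j < N) (a j < x)%R)%N.

Section chernoff.
Context {d : measure_display} {T : measurableType d} {R : realType}.
Variables (P : probability T R) (F : probability R R).

Lemma pr_gt_law (X : {RV P >-> R}) s : has_law X F ->
  pr P [set w | s < X w] = survival F s.
Proof.
move=> XF; rewrite /pr /survival /tail -XF//; congr (fine (P _)).
by apply/seteqP; split => w /=; rewrite in_itv/= andbT.
Qed.

Lemma measurable_RV (X : {RV P >-> R}) : measurable_fun setT X.
Proof. exact: measurable_funPT. Qed.

Lemma pr_le_law (X : {RV P >-> R}) s : has_law X F ->
  pr P [set w | X w <= s] = 1 - survival F s.
Proof.
move=> XF; rewrite -(pr_gt_law s XF) -pr_setC//; last first.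
  by apply: measurable_lt_RV; exact: measurable_RV.
by congr pr; apply/seteqP; split => w /=; rewrite leNgt => /negP.
Qed.

Lemma survival_cvg0 (X : {RV P >-> R}) : has_law X F ->
  forall eps, 0 < eps -> exists s, survival F s <= eps.
Proof.
move=> XF eps e0; have /fine_cvgP[_ /cvgrPdist_le/(_ _ e0)] := cvg_ccdfy0 X.
move=> [s [_ hs]]; exists (s + 1); have := hs (s + 1) ltac:(by rewrite ltrDl).
rewrite sub0r normrN ger0_norm/=; last by rewrite fine_ge0.
by rewrite -(pr_gt_law _ XF) /pr /ccdf /distribution /pushforward; congr (fine (P _) <= _);
   apply/seteqP; split => w /=; rewrite in_itv/= andbT.
Qed.

Lemma measurable_count (X : {RV P >-> R}) a N :
  measurable_fun setT (fun w => (count_above a N (X w))%:R : R).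
Proof.
rewrite /count_above; under eq_fun do rewrite natr_sum.
apply: measurable_sum => j.
rewrite (_ : (fun _ => _) = \1_[set w | a j < X w]).
  by apply: measurable_indic; apply: measurable_lt_RV; exact: measurable_RV.
apply/funext => w; rewrite indicE; congr (nat_of_bool _)%:R.
by apply/idP/idP; rewrite inE.
Qed.

Variables (X : nat -> {RV P >-> R}) (M : R).
Hypotheses (XF : forall i, has_law (X i) F) (XM : enod X M).

Lemma enod_gt0 : 0 < M. Proof. by case: XM. Qed.

Lemma enod_gt n (x : 'I_n -> R) : (0 < n)%N ->
  pr P [set w | forall i : 'I_n, x i < X i w] <= M * \prod_i survival F (x i).
Proof.
case: XM => _ /(_ n x)/[apply] -[+ _].
have mA (i : 'I_n) : measurable [set w | x i < X i w].
  by apply: measurable_lt_RV; exact: measurable_RV.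
rewrite (prE P); last exact: measurable_forall_ord.
rewrite (eq_bigr (fun i => (survival F (x i))%:E)).
  by rewrite prodEFin -EFinM lee_fin.
by move=> i _; rewrite (prE P)// pr_gt_law.
Qed.

Lemma enod_le n (x : 'I_n -> R) : (0 < n)%N ->
  pr P [set w | forall i : 'I_n, X i w <= x i] <= M * \prod_i (1 - survival F (x i)).
Proof.
case: XM => _ /(_ n x)/[apply] -[_ +].
have mA (i : 'I_n) : measurable [set w | X i w <= x i].
  by apply: measurable_le_RV; exact: measurable_RV.
rewrite (prE P); last exact: measurable_forall_ord.
rewrite (eq_bigr (fun i => (1 - survival F (x i))%:E)).
  by rewrite prodEFin -EFinM lee_fin.
by move=> i _; rewrite (prE P)// pr_le_law.
Qed.

Lemma pr_exists_gt_le n s :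
  pr P [set w | exists2 i, (i < n)%N & s < X i w] <= n%:R * survival F s.
Proof.
have mA i : measurable [set w | s < X i w].
  by apply: measurable_lt_RV; exact: measurable_RV.
apply: (le_trans (pr_exists_le P n mA)).
under eq_bigr do rewrite pr_gt_law//.
by rewrite sumr_const card_ord mulr_natl.
Qed.

Section count_thresholds.
Variables (a : nat -> R) (a_le : {homo a : i j / (i <= j)%N >-> i <= j}).

(** By Abel summation the exponential of the count is a combination of the
indicators of [a j < X i] with nonnegative coefficients, plus a constant. *)
Lemma chernoff_upper n N theta b : nonneg_law F -> (0 < n)%N -> 0 <= theta ->
  pr P [set w | b < \sum_(i < n) (count_above a N (X i w))%:R] <=
  M * expR (- (theta * b)) *
    (1 + \sum_(j < N) (expR (theta * j.+1%:R) - expR (theta * j%:R)) * survival F (a j)) ^+ n.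
Proof.
move=> F0 n0 th0; set B := [set w | _].
pose C := [set w | forall i : 'I_n, -1 < X i w].
have mB : measurable B.
  by apply: measurable_lt_RV; apply: measurable_sum => i; exact: measurable_count.
have mC : measurable C.
  apply: measurable_forall_ord => i.
  by apply: measurable_lt_RV; exact: measurable_RV.
have BC : pr P B <= pr P (B `&` C).
  pose D := [set w | exists2 i, (i < n)%N & X i w <= -1].
  have mX i : measurable [set w | X i w <= -1].
    by apply: measurable_le_RV; exact: measurable_RV.
  have mD : measurable D by exact: measurable_exists_lt.
  have D0 : pr P D <= 0.
    apply: (le_trans (pr_exists_le P n mX)); rewrite big1// => i _.
    by rewrite pr_le_law// survival_lt0 ?subrr.
  have mBC : measurable (B `&` C) by exact: measurableI.
  apply: (@le_trans _ _ (pr P ((B `&` C) `|` D))).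
    apply: le_pr => //; first exact: measurableU.
    move=> w Bw; have [Cw|/existsNP[i /negP]] := pselect (C w); first by left.
    by rewrite -leNgt => h; right; exists i.
  by apply: (le_trans (prU_le _ _ _)) => //; rewrite gerDl.
apply: (le_trans BC).
rewrite -mulrA mulrCA expRN ler_pdivlMl ?expR_gt0//.
(* the threshold -1 stands for the constant term of the step function *)
pose t (j : 'I_N.+1) := if unlift ord0 j is Some k then a k else -1.
pose co (j : 'I_N.+1) := if unlift ord0 j is Some k then
   expR (theta * k.+1%:R) - expR (theta * k%:R) else 1.
pose p (j : 'I_N.+1) := survival F (t j).
rewrite [X in _ * X ^+ n](_ : _ = \sum_(j < N.+1) co j * p j); last first.
  rewrite big_ord_recl /co /p /t unlift_none mul1r survival_lt0//; congr (_ + _).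
  by apply: eq_bigr => j _; rewrite liftK.
apply: (markov_prod (A := fun i j => [set w | t j < X i w])) => //.
- by move=> i j; apply: measurable_lt_RV; exact: measurable_RV.
- move=> j; rewrite /co; case: unliftP => // k _; rewrite subr_ge0 ler_expR.
  by rewrite ler_wpM2l// ler_nat.
- by move=> s; exact: enod_gt.
- exact: measurableI.
move=> w [Bw Cw]; apply: (@le_trans _ _
   (expR (theta * \sum_(i < n) (count_above a N (X i w))%:R))).
  by rewrite ler_expR ler_wpM2l// ltW.
rewrite mulr_sumr expR_sum; apply: ler_prod => i _; rewrite expR_ge0/=.
rewrite /count_above (abel_count (fun k => expR (theta * k%:R)) (b := fun j => a j < X i w))/=; last first.
  by move=> j; apply: le_lt_trans; apply: a_le.
rewrite mulr0 expR0 big_ord_recl /co /t unlift_none mul1r indicE mem_set//=.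
rewrite lerD2l; apply: ler_sum => j _; rewrite liftK indicE.
by rewrite [X in _ <= _ * (nat_of_bool X)%:R](_ : _ = (a j < X i w))//;
   apply/idP/idP; rewrite inE.
Qed.

(** Dual to [chernoff_upper], with the indicators of [X i <= a j]. The constant term
is now the indicator of no half-line [X i <= s], only a limit of such. *)
Lemma chernoff_lower n N theta b : (0 < n)%N -> 0 <= theta ->
  pr P [set w | \sum_(i < n) (count_above a N (X i w))%:R <= b] <=
  M * expR (theta * b) *
    (1 - \sum_(j < N) (expR (- (theta * j%:R)) - expR (- (theta * j.+1%:R)))
      * survival F (a j)) ^+ n.
Proof.
move=> n0 th0; set B := [set w | _]; set rhs := (X in _ <= X).
pose c j := expR (- (theta * j%:R)) - expR (- (theta * j.+1%:R)).
have c0 j : 0 <= c j by rewrite subr_ge0 ler_expR lerN2 ler_wpM2l// ler_nat.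
have sumc : \sum_(j < N) c j = 1 - expR (- (theta * N%:R)).
  elim: N {B rhs} => [|N' IH]; first by rewrite big_ord0 mulr0 oppr0 expR0 subrr.
  by rewrite big_ord_recr/= IH /c; ring.
have mB : measurable B.
  by apply: measurable_le_RV; apply: measurable_sum => i; exact: measurable_count.
apply/ler_addgt0Pr => eps e0.
have en0 : 0 < eps / n%:R by rewrite divr_gt0// ltr0n.
have [m hm] := survival_cvg0 (XF 0) en0.
pose C := [set w | forall i : 'I_n, X i w <= m].
pose D := [set w | exists2 i, (i < n)%N & m < X i w].
have mC : measurable C.
  apply: measurable_forall_ord => i.
  by apply: measurable_le_RV; exact: measurable_RV.
have mX i : measurable [set w | m < X i w].
  by apply: measurable_lt_RV; exact: measurable_RV.
have mD : measurable D by exact: measurable_exists_lt.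
have mBC : measurable (B `&` C) by exact: measurableI.
apply: (@le_trans _ _ (pr P ((B `&` C) `|` D))).
  apply: le_pr => //; first exact: measurableU.
  move=> w Bw; have [Cw|/existsNP[i /negP]] := pselect (C w); first by left.
  by rewrite -ltNge => h; right; exists i.
apply: (le_trans (prU_le _ _ _)) => //; apply: lerD; last first.
  apply: (le_trans (pr_exists_gt_le _ _)).
  by rewrite mulrC -ler_pdivlMr// ltr0n.
rewrite /rhs -mulrA mulrCA -[expR (theta * b)]invrK -expRN.
rewrite ler_pdivlMl ?expR_gt0//.
(* the threshold m, eventually sent to infinity, stands for the constant term *)
pose t (j : 'I_N.+1) := if unlift ord0 j is Some k then a k else m.
pose co (j : 'I_N.+1) := if unlift ord0 j is Some k then c k
   else expR (- (theta * N%:R)).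
pose p (j : 'I_N.+1) := 1 - survival F (t j).
have co0 j : 0 <= co j by rewrite /co; case: unliftP => // *; exact: expR_ge0.
have p0 j : 0 <= p j by rewrite subr_ge0; exact: survival_le1.
apply: (@le_trans _ _ (M * (\sum_(j < N.+1) co j * p j) ^+ n)); last first.
  rewrite ler_pM2l ?enod_gt0//; apply: lerXn2r.
  - by rewrite nnegrE sumr_ge0// => j _; rewrite mulr_ge0.
  - rewrite nnegrE subr_ge0; apply: (@le_trans _ _ (\sum_(j < N) c j)).
      apply: ler_sum => j _; apply: ler_piMr.
      exact: c0.
    exact: survival_le1.
    by rewrite sumc gerBl expR_ge0.
  rewrite big_ord_recl /co /p /t unlift_none.
  under eq_bigr do rewrite liftK mulrBr mulr1.
  rewrite sumrB sumc.
  have := mulr_ge0 (expR_ge0 (- (theta * N%:R))) (survival_ge0 F m).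
  set S := \sum_(j < N) _; move: (expR _) => e; lra.
apply: (markov_prod (A := fun i j => [set w | X i w <= t j])) => //.
- by move=> i j; apply: measurable_le_RV; exact: measurable_RV.
- by move=> s; exact: enod_le.
move=> w [Bw Cw]; apply: (@le_trans _ _
   (expR (- (theta * \sum_(i < n) (count_above a N (X i w))%:R)))).
  by rewrite ler_expR lerN2 ler_wpM2l.
rewrite mulr_sumr -sumrN expR_sum; apply: ler_prod => i _; rewrite expR_ge0/=.
rewrite /count_above (abel_count (fun k => expR (- (theta * k%:R))) (b := fun j => a j < X i w))/=; last first.
  by move=> j; apply: le_lt_trans; apply: a_le.
rewrite mulr0 oppr0 expR0 big_ord_recl /co /t unlift_none indicE mem_set//=.
rewrite mulr1.
have -> : expR (- (theta * N%:R)) = 1 - \sum_(j < N) c j by rewrite sumc; ring.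
rewrite -addrA lerD2l -sumrN -big_split/=; apply: ler_sum => j _.
rewrite liftK indicE.
rewrite [X in _ <= _ + _ * (nat_of_bool X)%:R](_ : _ = (X i w <= a j)); last first.
  by apply/idP/idP; rewrite inE.
rewrite /c; case: ltrP => _ /=; rewrite ?mulr1 ?mulr0; lra.
Qed.

End count_thresholds.
End chernoff.

(** * Tail sums and the mean *)

Section tail_sums.
Context {R : realType}.
Variables (F : probability R R) (mu : R).
Hypotheses (F0 : nonneg_law F) (Fmu : has_mean F mu).

Lemma integral_pospart : (\int[F]_x (Num.max x 0)%:E)%E = mu%:E.
Proof.
case: Fmu => _ <-; apply: ae_eq_integral => //.
- by apply/measurable_EFinP; exact: measurable_maxr.
exists `]-oo, 0[%classic; split => // x /= /not_implyP[_ ne].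
rewrite in_itv/= ltNge; apply/negP => x0; apply: ne.
by rewrite max_l.
Qed.

Lemma mean_ge0 : 0 <= mu.
Proof.
rewrite -lee_fin -integral_pospart; apply: integral_ge0 => x _.
by rewrite lee_fin le_max lexx orbT.
Qed.

Section lattice.
Variables (eta : R) (eta0 : 0 < eta).

Let grid (j : nat) : R := j.+1%:R * eta.

Lemma pr_above s : pr F [set x | s < x] = survival F s.
Proof.
rewrite survivalE; congr pr; apply/seteqP; split => x /=;
  by rewrite in_itv/= andbT.
Qed.

Lemma measurable_above (s : R) : measurable [set x : R | s < x].
Proof. exact: measurable_lt_RV. Qed.

Lemma indic_above (s x : R) : \1_[set z : R | s < z] x = (s < x)%R%:R :> R.
Proof.
by rewrite indicE; congr (nat_of_bool _)%:R; apply/idP/idP; rewrite inE.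
Qed.

Lemma sum_above_le N (x : R) :
  \sum_(j < N) eta * (grid j < x)%R%:R <= Num.max x 0.
Proof.
elim: N => [|N IH]; first by rewrite big_ord0 le_max lexx orbT.
rewrite big_ord_recr/=; case: ltP => [h|_]; last by rewrite mulr0 addr0.
rewrite mulr1 le_max; apply/orP; left; apply: le_trans (ltW h).
rewrite /grid -natr1 mulrDl mul1r lerD2r.
apply: (@le_trans _ _ (\sum_(j < N) eta)).
  apply: ler_sum => j _; rewrite ler_piMr// ?(ltW eta0)//.
  by case: (_ < _).
by rewrite sumr_const card_ord mulr_natl.
Qed.

Lemma sum_above_ge N (x : R) :
  Num.min (Num.max x 0) (grid N) <= eta + \sum_(j < N) eta * (grid j < x)%R%:R.
Proof.
elim: N => [|N IH]; first by rewrite big_ord0 addr0 /grid mul1r ge_min lexx orbT.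
have gS : grid N.+1 = eta + grid N by rewrite /grid -[in LHS]natr1; ring.
have gN : 0 <= grid N by rewrite /grid mulr_ge0// ltW.
rewrite big_ord_recr/= addrA; case: ltP => [h|h]; last first.
  rewrite mulr0 addr0; apply: le_trans IH.
  have xN : Num.max x 0 <= grid N by rewrite ge_max h.
  by rewrite (min_l xN) ge_min lexx.
rewrite mulr1; move: IH; rewrite min_r; last by rewrite le_max ltW.
by rewrite gS => IH; rewrite ge_min; apply/orP; right; lra.
Qed.

Lemma tail_sum_le N : \sum_(j < N) eta * survival F (grid j) <= mu.
Proof.
rewrite -lee_fin -integral_pospart.
under eq_bigr do rewrite -pr_above.
rewrite -integral_step; last 2 first.
- by move=> j; exact: ltW.
- by move=> j; exact: measurable_above.
apply: ge0_le_integral => //.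
- by move=> x _; rewrite lee_fin sumr_ge0// => j _; rewrite mulr_ge0// ltW.
- apply/measurable_EFinP; apply: measurable_sum => j.
  apply: measurable_funM => //; apply: measurable_indic.
  exact: measurable_above.
- by apply/measurable_EFinP; exact: measurable_maxr.
- move=> x _; rewrite lee_fin; under eq_bigr do rewrite indic_above.
  exact: sum_above_le.
Qed.

(** A nonnegative number exceeds its lattice approximation from below by at most one
step; after monotone convergence, a finite part of the series comes within [eps]. *)
Lemma tail_sum_ge eps : 0 < eps ->
  exists N, mu - eta - eps <= \sum_(j < N) eta * survival F (grid j).
Proof.
move=> e0; apply: contrapT => /forallNP hN.
have hN' N : \sum_(j < N) eta * survival F (grid j) <= mu - eta - eps.
  by apply: ltW; rewrite ltNge; apply/negP/hN.
suff : (mu%:E <= eta%:E + (mu - eta - eps)%:E)%E by rewrite -EFinD lee_fin; lra.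
pose f j (x : R) : \bar R := (eta * \1_[set z | grid j < z] x)%:E.
have mf j : measurable_fun setT (f j).
  apply/measurable_EFinP; apply: measurable_funM => //; apply: measurable_indic.
  exact: measurable_above.
have f0 j x : (0 <= f j x)%E by rewrite lee_fin mulr_ge0// ltW.
rewrite -integral_pospart.
apply: (@le_trans _ _ (\int[F]_x (eta%:E + \sum_(0 <= j <oo) f j x))%E).
  apply: ge0_le_integral => //.
  - by move=> x _; rewrite lee_fin le_max lexx orbT.
  - by apply/measurable_EFinP; exact: measurable_maxr.
  - apply: emeasurable_funD => //; exact: ge0_emeasurable_sum.
  move=> x _.
  pose N := Num.trunc (Num.max x 0 / eta).
  have xN : Num.max x 0 <= grid N.
    by rewrite /grid -ler_pdivrMr//; apply: ltW; exact: truncnS_gt.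
  have := sum_above_ge N x; rewrite min_l// => h.
  apply: (@le_trans _ _ (eta%:E + \sum_(0 <= j < N) f j x)%E).
    rewrite big_mkord sumEFin -EFinD lee_fin.
    by under eq_bigr do rewrite indic_above.
  by rewrite leeD2l// nneseries_lim_ge.
rewrite ge0_integralD//; last 3 first.
- by move=> x _; rewrite lee_fin ltW.
- by move=> x _; exact: nneseries_ge0.
- by exact: ge0_emeasurable_sum.
rewrite integral_cst// [X in (_ * X)%E]probability_setT mule1 leeD2l//.
rewrite integral_nneseries//; apply: lime_le.
  by apply: is_cvg_nneseries => j _ _; apply: integral_ge0.
apply: nearW => N; rewrite big_mkord.
apply: (@le_trans _ _ (\sum_(j < N) eta * survival F (grid j))%:E); last first.
  by rewrite lee_fin.
rewrite -sumEFin; apply: lee_sum => j _.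
under eq_integral do rewrite /f EFinM.
rewrite ge0_integralZl_EFin//; last 2 first.
- by apply/measurable_EFinP; apply: measurable_indic; exact: measurable_above.
- exact: ltW.
rewrite integral_indic//; last exact: measurable_above.
rewrite setIT EFinM -pr_above le_eqVlt; apply/orP; left; apply/eqP.
by congr (_ * _)%E; apply: prE; exact: measurable_above.
Qed.

(** The tail sums converge, so a dyadic block of them is eventually small; all
its terms are at least [survival F (n * eta)]. *)
Lemma survival_mul_cvg0 eps : 0 < eps ->
  \forall n \near \oo, n%:R * survival F (n%:R * eta) <= eps.
Proof.
move=> e0; pose S N := \sum_(j < N) eta * survival F (grid j).
pose e1 := eps * eta / 2.
have e10 : 0 < e1 by rewrite divr_gt0// mulr_gt0.
have hs : has_sup (range S).
  split; first by exists (S 0%N), 0%N.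
  by exists mu => _ [N _ <-]; exact: tail_sum_le.
have [_ [N0 _ <-] hN0] := sup_adherent e10 hs.
have block N k : S N + k%:R * (eta * survival F ((N + k)%:R * eta)) <= S (N + k)%N.
  rewrite /S big_split_ord/= lerD2l.
  apply: (@le_trans _ _ (\sum_(j < k) eta * survival F ((N + k)%:R * eta))).
    by rewrite sumr_const card_ord mulr_natl.
  apply: ler_sum => j _; rewrite ler_pM2l//; apply: survival_le.
  by rewrite /grid ler_pM2r// ler_nat -addnS leq_add2l.
near=> n.
have nN0 : (N0 + N0 <= n)%N by near: n; exact: nbhs_infty_ge.
have N0n : (N0 <= n)%N by apply: leq_trans nN0; exact: leq_addr.
have := block N0 (n - N0)%N; rewrite subnKC// natrB// => hb.
have Sn : S n <= sup (range S) by apply: ub_le_sup; [case: hs|exists n].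
move: nN0; rewrite -(ler_nat R) natrD => nN0.
have := survival_ge0 F (n%:R * eta); move: hb hN0.
set s := survival F _; set a : R := n%:R in nN0 *; set b : R := N0%:R in nN0 *.
move: (S _) (S _) (sup _) Sn => s1 s2 s3 Sn hb hN0 s0.
have h1 : (a - b) * (eta * s) <= e1 by lra.
have h2 : a * (eta * s) <= 2 * ((a - b) * (eta * s)).
  have : 0 <= (a - b - b) * (eta * s) by rewrite mulr_ge0 ?mulr_ge0 ?(ltW eta0)//; lra.
  lra.
rewrite -(ler_pM2l eta0) mulrCA; apply: (le_trans h2).
rewrite /e1 in h1; lra.
Unshelve. all: by end_near. Qed.

End lattice.
End tail_sums.

(** * The truncated sums *)

Lemma natr_le_expr (R : realType) (y c : R) : 1 < y -> 0 < c ->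
  exists K, forall k, (K <= k)%N -> k%:R <= c * y ^+ k.
Proof.
move=> y1 c0; have L0 : 0 < ln y by rewrite ln_gt0.
have cL0 : 0 < c * ln y ^+ 2 by rewrite mulr_gt0// exprn_gt0.
exists (Num.trunc (2 / (c * ln y ^+ 2))).+1 => k hk.
have kb : 2 <= c * ln y ^+ 2 * k%:R.
  rewrite mulrC -ler_pdivrMr//; apply: ltW; apply: lt_le_trans (truncnS_gt _) _.
  by rewrite ler_nat.
have : (k%:R * ln y) ^+ 2 / 2 <= y ^+ k.
  rewrite -[y in y ^+ k]lnK ?posrE ?(lt_trans _ y1)// -expRM_natl.
  have := @expR_ge1Dxn _ (k%:R * ln y) 1 ltac:(by rewrite mulr_ge0// ltW).
  by apply: le_trans; rewrite lerDr.
rewrite -(ler_pM2l c0); apply: le_trans.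
have k0 : 0 <= k%:R :> R by [].
have : 2 * k%:R <= c * ln y ^+ 2 * k%:R * k%:R by rewrite ler_wpM2r.
by move=> h; lra.
Qed.

Lemma inv_expr_four (R : realType) k : ((2 ^+ k) ^+ 4)^-1 = (4 ^- k) ^+ 2 :> R.
Proof.
have -> : 4 = 2 ^+ 2 :> R by rewrite expr2; ring.
rewrite exprVn -[in RHS]exprM mulnC exprM -[in RHS]exprM -[in LHS]exprM.
by rewrite -[in RHS]exprM mulnA [in RHS]mulnC.
Qed.

Section truncated.
Context {d : measure_display} {T : measurableType d} {R : realType}.
Variables (P : probability T R) (F : probability R R).
Variables (X : nat -> {RV P >-> R}) (M mu : R) (g : R -> R).
Hypotheses (XF : forall i, has_law (X i) F) (XM : enod X M).
Hypotheses (F0 : nonneg_law F) (Fmu : has_mean F mu).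
Hypotheses (g_le : {homo g : x y /~ x <= y}) (gC : consistent g).
Hypothesis g_cvg0 : forall eta eps : R, 0 < eta -> 0 < eps ->
  \forall n \near \oo, n%:R * g (n%:R * eta) <= eps.
Hypothesis Fg : exists x1, forall x, x1 <= x -> survival F x <= g x.

Lemma expRB_le (a b : R) : expR b - expR a <= (b - a) * expR b.
Proof.
have := expR_ge1Dx (a - b); rewrite expRD expRN => h.
have : (1 + (a - b)) * expR b <= expR a / expR b * expR b.
  by rewrite ler_pM2r ?expR_gt0.
rewrite mulfVK ?gt_eqF ?expR_gt0//; lra.
Qed.

Lemma expR_MnatK (k n : nat) : (0 < n)%N ->
  expR (k%:R * ln 2 / n%:R * n%:R) = 2 ^+ k :> R.
Proof. by move=> n0; rewrite mulfVK ?pnatr_eq0 -?lt0n// expRM_natl lnK ?posrE. Qed.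

(** Chernoff's inequality at [theta = k * ln 2 / n], where [4 ^- k] is about
[n * g (n * eta)]. Below level [n / y ^+ k] the exponential is almost linear, so
that this part costs only the mean; above it, the crude bound [2 ^+ k] is
compensated by the tail, which exceeds [g (n * eta)] by a factor [2 ^+ k] at
most. *)
Lemma truncated_sum_le (eta : R) : 0 < eta ->
  exists C : R, \forall n \near \oo,
    pr P [set w | n%:R * (mu / eta + 7) <
      \sum_(i < n) (count_above (fun j => j%:R * eta) n (X i w))%:R] <=
    C * (n%:R * g (n%:R * eta)) ^+ 2.
Proof.
move=> eta0; have g0 := consistent_gt0 g_le gC; have M0 := enod_gt0 XM.
have mu0 := mean_ge0 F0 Fmu.
have [y [x0' [y1 x00' gy']]] := consistent_double gC.
have [x1 Fgx1] := Fg.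
pose x0 := Num.max x0' x1.
have x00 : 0 < x0 by rewrite lt_max x00'.
have gy x : x0 <= x -> g x <= 2 * g (x * y).
  by rewrite ge_max => /andP[/gy'].
have Fgx x : x0 <= x -> survival F x <= g x.
  by rewrite ge_max => /andP[_ /Fgx1].
pose m := mu / eta + 1.
have m1 : 1 <= m by rewrite lerDr divr_ge0// ltW.
have m0 : 0 < m by rewrite (lt_le_trans _ m1).
(* replacing m by expR dl * m costs 2 of the 7 units of slack *)
pose dl := ln (1 + 2 / m).
have edl : expR dl * m = m + 2.
  rewrite /dl lnK ?posrE ?addr_gt0 ?divr_gt0//.
  by rewrite mulrDl mul1r mulfVK ?gt_eqF.
have dl0 : 0 < dl by rewrite ln_gt0// ltrDl divr_gt0.
have ln20 : 0 < ln 2 :> R by rewrite ln_gt0// ltr1n.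
have A0 : 0 < ln 2 * (1 + eta / x0) by rewrite mulr_gt0// addr_gt0// divr_gt0.
have [K hK] := natr_le_expr y1 (divr_gt0 dl0 A0).
exists (16 * M * expR 1).
have q4K : 0 < 4 ^- K :> R by rewrite invr_gt0 exprn_gt0.
near=> n.
have n0 : (0 < n)%N by near: n; exact: nbhs_infty_gt.
have nR0 : 0 < n%:R :> R by rewrite ltr0n.
have hq : n%:R * g (n%:R * eta) <= 4 ^- K by near: n; exact: g_cvg0.
have hn : Num.max (g (x0 * y))^-1 (x0 / eta) < n%:R by near: n; exact: nbhs_infty_gtr.
move: hn; rewrite gt_max => /andP[hn1 hn2].
have {}hn1 : 1 < n%:R * g (x0 * y) by rewrite -ltr_pdivrMr// div1r.
have {}hn2 : x0 <= n%:R * eta by rewrite -ler_pdivrMr// ltW.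
pose V := n%:R * eta; rewrite -/V in hq hn2 *.
have V0 : 0 < V by rewrite mulr_gt0.
pose q := n%:R * g V; rewrite -/q in hq *.
have q0 : 0 < q by rewrite mulr_gt0.
(* minimality of the exponent makes 4 ^- k comparable to q from both sides *)
have [k [Kk kq1 kq2]] : exists k, [/\ (K <= k)%N, 4 ^+ k * q <= 1 & 1 < 4 ^+ k.+1 * q].
  have ex : exists k, 1 < 4 ^+ k * q.
    have [k hk] := @exists_expr_ge R 4 (q^-1 + 1) ltac:(by rewrite ltr1n).
    by exists k; rewrite -ltr_pdivrMr// div1r; apply: lt_le_trans hk; rewrite ltrDl.
  case: (ex_minnP ex) => -[|k] hk kmin.
    move: hk; rewrite expr0 mul1r ltNge (le_trans hq)//.
    by rewrite invf_le1 ?exprn_gt0// exprn_ege1// ler1n.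
  exists k; split => //.
    rewrite leqNgt; apply/negP => kK; move: hk; rewrite ltNge; apply/negP.
    rewrite negbK; apply: (@le_trans _ _ (4 ^+ K * q)).
      by rewrite ler_pM2r// ler_weXn2l// ler1n.
    by rewrite -ler_pdivlMl ?exprn_gt0// mulr1.
  by rewrite leNgt; apply/negP => /kmin; rewrite ltnn.
have yk0 : 0 < y ^+ k by rewrite exprn_gt0// (lt_trans _ y1).
have [[x0V gV]|gV] := doubling_down g_le g0 y1 gy k hn2; last first.
  (* a descent that left the doubling range would make q too large for k *)
  exfalso; move: hn1; apply/negP; rewrite -leNgt.
  apply: (@le_trans _ _ (n%:R * (2 ^+ k * g V))); first by rewrite ler_pM2l.
  rewrite mulrCA; apply: le_trans kq1; rewrite ler_pM2r//.
  by apply: lerXn2r; rewrite ?nnegrE// ler_nat.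
pose J := (Num.trunc (n%:R / y ^+ k)).+1.
have nyk : 0 <= n%:R / y ^+ k by rewrite divr_ge0// ltW.
have Jlow : n%:R / y ^+ k < J%:R by exact: truncnS_gt.
have Jup : J%:R <= n%:R / y ^+ k + 1.
  by rewrite -natr1 lerD2r; have /andP[] := truncn_itv nyk.
pose theta : R := k%:R * ln 2 / n%:R.
have th0 : 0 <= theta by rewrite divr_ge0// mulr_ge0// ltW.
have thn : expR (theta * n%:R) = 2 ^+ k by exact: expR_MnatK.
have thJ : theta * J%:R <= dl.
  apply: (@le_trans _ _ (k%:R * (ln 2 * (1 + eta / x0)) / y ^+ k)); last first.
    rewrite ler_pdivrMr// -ler_pdivlMr//.
    by apply: (le_trans (hK _ Kk)); rewrite mulrAC.
  rewrite /theta -!mulrA ler_wpM2l// ler_pM2l//.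
  have n1 : n%:R^-1 <= eta / x0 / y ^+ k.
    rewrite ler_pdivlMr// ler_pdivlMr// -mulrA ler_pdivrMl// mulrC.
    by rewrite -ler_pdivlMr.
  apply: (@le_trans _ _ (n%:R^-1 * (n%:R / y ^+ k + 1))).
    by rewrite ler_wpM2l// invr_ge0 ltW.
  by rewrite mulrDr mulr1 mulrA mulVf ?gt_eqF// mulrDl lerD2l.
pose D (j : nat) := expR (theta * j.+1%:R) - expR (theta * j%:R).
have D0 j : 0 <= D j by rewrite subr_ge0 ler_expR ler_wpM2l// ler_nat.
have sumD : \sum_(j < n) D j = 2 ^+ k - 1.
  rewrite -thn; elim: (n) => [|n' IH]; first by rewrite big_ord0 mulr0 expR0 subrr.
  by rewrite big_ord_recr/= IH /D; ring.
have a_le : {homo (fun j => j%:R * eta) : i j / (i <= j)%N >-> i <= j}.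
  by move=> i j ij; rewrite ler_pM2r// ler_nat.
apply: (le_trans (chernoff_upper XF XM a_le n _ F0 n0 th0)).
have tailsum : \sum_(j < n) survival F (j%:R * eta) <= m.
  apply: (@le_trans _ _ (1 + \sum_(j < n) survival F (j.+1%:R * eta))).
    case: (n) => [|n']; first by rewrite !big_ord0.
    rewrite big_ord_recl/= lerD ?survival_le1//.
    by rewrite [leRHS]big_ord_recr/= lerDl survival_ge0.
  rewrite addrC lerD2r ler_pdivlMr// mulrC mulr_sumr.
  exact: tail_sum_le.
have mgf : \sum_(j < n) D j * survival F (j%:R * eta) <=
    theta * (m + 2) + n%:R^-1.
  apply: (@le_trans _ _ (\sum_(j < n) (theta * expR dl * survival F (j%:R * eta) +
      D j * (2 ^+ k * g V)))).
    apply: ler_sum => j _; have [jJ|Jj] := ltnP j J.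
      rewrite -[leLHS]addr0 lerD//; last first.
        by rewrite mulr_ge0// mulr_ge0// ltW.
      rewrite ler_wpM2r ?survival_ge0//; apply: (le_trans (expRB_le _ _)).
      have -> : theta * j.+1%:R - theta * j%:R = theta by rewrite -natr1; ring.
      rewrite ler_wpM2l// ler_expR.
      by apply: le_trans thJ; rewrite ler_wpM2l// ler_nat.
    rewrite -[leLHS]add0r lerD//.
      by rewrite mulr_ge0 ?survival_ge0// mulr_ge0// expR_ge0.
    rewrite ler_wpM2l//.
    have Vj : V / y ^+ k <= j%:R * eta.
      rewrite /V mulrAC ler_pM2r//; apply: (le_trans (ltW Jlow)).
      by rewrite ler_nat.
    apply: (le_trans (Fgx _ _)); first exact: le_trans Vj.
    by apply: le_trans gV; apply: g_le.
  rewrite big_split/= -mulr_sumr -mulr_suml sumD lerD//.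
    rewrite -mulrA ler_wpM2l// -edl ler_wpM2l//.
  apply: (@le_trans _ _ (2 ^+ k * (2 ^+ k * g V))).
    by rewrite ler_pM2r ?mulr_gt0 ?exprn_gt0// gerDl lerN10.
  rewrite -[leRHS]mulr1 ler_pdivlMl// mulrA -exprMn mulrCA.
  rewrite (_ : 2 * 2 = 4); last by ring.
  exact: kq1.
have step : (1 + \sum_(j < n) D j * survival F (j%:R * eta)) ^+ n <=
    expR (theta * (m + 2) * n%:R + 1).
  apply: (@le_trans _ _ (expR (theta * (m + 2) + n%:R^-1) ^+ n)).
    apply: lerXn2r; rewrite ?nnegrE ?expR_ge0//.
      by rewrite addr_ge0// sumr_ge0// => j _; rewrite mulr_ge0 ?survival_ge0.
    by apply: le_trans (expR_ge1Dx _); rewrite lerD2l.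
  by rewrite -expRM_natl mulrDr mulfV ?gt_eqF// [n%:R * _]mulrC.
apply: (le_trans (ler_wpM2l _ step)).
  by rewrite mulr_ge0 ?expR_ge0// ltW.
rewrite -[leLHS]mulrA -expRD.
have -> : - (theta * (n%:R * (mu / eta + 7))) + (theta * (m + 2) * n%:R + 1) =
    1 - (theta * n%:R) *+ 4 by rewrite /m; ring.
rewrite expRB -mulr_natl expRM_natl thn -/q.
have -> : 16 * M * expR 1 * q ^+ 2 = M * (expR 1 * (16 * q ^+ 2)) by ring.
rewrite ler_pM2l// ler_pM2l ?expR_gt0//.
have k4 : 4 ^- k <= 4 * q.
  rewrite -[leLHS]mul1r ler_pdivrMr ?exprn_gt0//.
  by rewrite mulrAC -exprS ltW.
rewrite inv_expr_four.
have -> : 16 * q ^+ 2 = (4 * q) ^+ 2 by ring.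
by apply: lerXn2r; rewrite // nnegrE; [rewrite invr_ge0 exprn_ge0|rewrite mulr_ge0// ltW].
Unshelve. all: by end_near. Qed.
End truncated.

(** * Sums of dependent claims and the single big jump *)

Section sums.
Context {d : measure_display} {T : measurableType d} {R : realType}.
Variables (P : probability T R) (F : probability R R).
Variables (X : nat -> {RV P >-> R}) (M mu : R).
Hypotheses (XF : forall i, has_law (X i) F) (XM : enod X M).
Hypotheses (F0 : nonneg_law F) (Fmu : has_mean F mu).

Lemma measurable_lt0 n : measurable [set w | exists2 i, (i < n)%N & X i w < 0].
Proof.
apply: measurable_exists_lt => k.
by apply: measurable_gt_RV; exact: measurable_RV.
Qed.

Lemma pr_exists_lt0 n : pr P [set w | exists2 i, (i < n)%N & X i w < 0] = 0.
Proof.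
have mX i : measurable [set w | X i w < 0].
  by apply: measurable_gt_RV; exact: measurable_RV.
apply/eqP; rewrite eq_le pr_ge0 andbT.
apply: (le_trans (pr_exists_le P n mX)); rewrite big1// => i _.
by rewrite /pr [P _](_ : _ = 0%E)// -[RHS]F0 -(XF i)//.
Qed.

(** The other thresholds are set to [-1], where they do not restrict anything. *)
Lemma pr_pair_le i j s : i != j ->
  pr P ([set w | s < X i w] `&` [set w | s < X j w]) <= M * survival F s ^+ 2.
Proof.
move=> ij; pose n := (maxn i j).+1.
have ilt : (i < n)%N by rewrite ltnS leq_maxl.
have jlt : (j < n)%N by rewrite ltnS leq_maxr.
pose I := Ordinal ilt; pose J := Ordinal jlt.
have IJ : J != I by rewrite eq_sym; apply: contra ij => /eqP[->].
pose x (k : 'I_n) := if (k == I) || (k == J) then s else -1.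
have mX k t : measurable [set w | t < X k w].
  by apply: measurable_lt_RV; exact: measurable_RV.
pose E := [set w | forall k : 'I_n, x k < X k w].
pose D := [set w | exists2 k, (k < n)%N & X k w < 0].
have mE : measurable E by apply: measurable_forall_ord => k; exact: mX.
have mD : measurable D by exact: measurable_lt0.
apply: (@le_trans _ _ (pr P E + pr P D)).
  apply: le_trans (prU_le P mE mD).
  apply: le_pr; [exact: measurableI|exact: measurableU|].
  move=> w [/= iw jw]; have [Dw|nDw] := pselect (D w); first by right.
  left => k; rewrite /x; case: eqP => [->//|_]; case: eqP => [->//|_] /=.
  rewrite ltNge; apply/negP => h; apply: nDw; exists k => //.
  exact: le_lt_trans h _.
rewrite pr_exists_lt0 addr0; apply: (le_trans (enod_gt XF XM x _)) => //.
rewrite ler_pM2l ?(enod_gt0 XM)// (bigD1 I)//= (bigD1 J)//= big1 ?mulr1.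
  by rewrite /x eqxx /= eqxx orbT expr2.
by move=> k /andP[/negPf kI /negPf kJ]; rewrite /x kI kJ survival_lt0.
Qed.

Lemma pr_two_le n s :
  pr P [set w | exists2 i, (i < n)%N &
    exists2 j, (j < n)%N & i != j /\ s < X i w /\ s < X j w] <=
  n%:R ^+ 2 * (M * survival F s ^+ 2).
Proof.
pose B i j := if i == j then set0 else [set w | s < X i w] `&` [set w | s < X j w].
have mX k t : measurable [set w | t < X k w].
  by apply: measurable_lt_RV; exact: measurable_RV.
have mB i j : measurable (B i j).
  by rewrite /B; case: ifP => // _; exact: measurableI.
have M0 := enod_gt0 XM.
have B0 i j : pr P (B i j) <= M * survival F s ^+ 2.
  rewrite /B; case: eqP => [_|/eqP]; last exact: pr_pair_le.
  by rewrite {1}/pr measure0/= mulr_ge0 ?exprn_ge0 ?survival_ge0// ltW.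
pose A i := [set w | exists2 j, (j < n)%N & B i j w].
have mA i : measurable (A i) by exact: measurable_exists_lt.
have A0 i : pr P (A i) <= n%:R * (M * survival F s ^+ 2).
  apply: (le_trans (pr_exists_le P n (mB i))).
  apply: (@le_trans _ _ (\sum_(j < n) M * survival F s ^+ 2)).
    by apply: ler_sum => j _; exact: B0.
  by rewrite sumr_const card_ord mulr_natl.
rewrite [X in pr P X](_ : _ = [set w | exists2 i, (i < n)%N & A i w]).
  apply: (le_trans (pr_exists_le P n mA)).
  apply: (@le_trans _ _ (\sum_(j < n) n%:R * (M * survival F s ^+ 2))).
    by apply: ler_sum => j _; exact: A0.
  by rewrite sumr_const card_ord -[leLHS]mulr_natl mulrA expr2.
apply/seteqP; split => w [i ilt].
  move=> [j jlt [ij [h1 h2]]]; exists i => //; exists j => //.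
  by rewrite /B (negPf ij).
move=> [j jlt]; rewrite /B; case: eqP => // /eqP ij [/= h1 h2].
by exists i => //; exists j.
Qed.

Lemma measurable_sumRV n : measurable_fun setT (fun w => \sum_(i < n) X i w).
Proof. by apply: measurable_sum => i; exact: measurable_RV. Qed.

Lemma min_le_count (eta : R) N x : 0 <= eta ->
  Num.min x (N%:R * eta) <= eta * (count_above (fun j => j%:R * eta) N x)%:R.
Proof.
move=> eta0; rewrite /count_above; elim: N => [|N IH].
  by rewrite big_ord0 mulr0 mul0r ge_min lexx orbT.
rewrite big_ord_recr natrD mulrDr; case: ltP => [h|h].
  rewrite mulr1 -natr1 mulrDl mul1r.
  have := IH; rewrite min_r ?(ltW h)// => IH'.
  by rewrite ge_min; apply/orP; right; rewrite lerD2r.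
by rewrite mulr0 addr0; apply: le_trans IH; rewrite (min_l h) ge_min lexx.
Qed.

(** The constant [7] is the slack that [truncated_sum_le] leaves, in units of the
truncation level per term. *)
Definition truncated_excess eta n :=
  [set w | n%:R * (mu + 7 * eta) < \sum_(i < n) Num.min (X i w) (n%:R * eta)].

Lemma measurable_truncated_excess eta n : measurable (truncated_excess eta n).
Proof.
apply: measurable_lt_RV; apply: measurable_sum => i.
by apply: measurable_minr => //; exact: measurable_RV.
Qed.

Lemma pr_truncated_excess_le eta n : 0 < eta ->
  pr P (truncated_excess eta n) <=
  pr P [set w | n%:R * (mu / eta + 7) <
      \sum_(i < n) (count_above (fun j => j%:R * eta) n (X i w))%:R].
Proof.
move=> eta0; apply: le_pr; first exact: measurable_truncated_excess.
  by apply: measurable_lt_RV; apply: measurable_sum => i; exact: measurable_count.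
move=> w /=; rewrite -(ltr_pM2l eta0); rewrite mulr_sumr.
rewrite (_ : eta * _ = n%:R * (mu + 7 * eta)); last by field; rewrite gt_eqF.
move=> /lt_le_trans; apply; apply: ler_sum => i _.
by apply: min_le_count; exact: ltW.
Qed.

(** Any term above the truncation level is charged in full, which is enough when the
tail is itself negligible. *)
Lemma pr_sum_gt_crude eta n : 0 <= eta ->
  pr P [set w | n%:R * (mu + 7 * eta) < \sum_(i < n) X i w] <=
  n%:R * survival F (n%:R * eta) + pr P (truncated_excess eta n).
Proof.
move=> eta0; pose A := [set w | exists2 i, (i < n)%N & n%:R * eta < X i w].
have mA : measurable A.
  apply: measurable_exists_lt => i.
  by apply: measurable_lt_RV; exact: measurable_RV.
have mB := measurable_truncated_excess eta n.
apply: (@le_trans _ _ (pr P A + pr P (truncated_excess eta n))); last first.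
  by rewrite lerD2r; exact: pr_exists_gt_le.
apply: le_trans (prU_le P mA mB); apply: le_pr.
- by apply: measurable_lt_RV; exact: measurable_sumRV.
- exact: measurableU.
move=> w /= h; have [Aw|nAw] := pselect (A w); [by left|right].
rewrite /truncated_excess/=; apply: (lt_le_trans h); apply: ler_sum => i _.
rewrite min_l// leNgt; apply/negP => hi; apply: nAw; by exists i.
Qed.

(** If at most one summand exceeds [n * eta], the others stay inside the truncated
sum, and it has to provide all the rest of [x] alone. *)
Lemma pr_sum_gt_le eta n x : 0 <= eta -> n%:R * (7 * eta) <= x ->
  pr P [set w | n%:R * mu + x < \sum_(i < n) X i w] <=
  n%:R * survival F (x - n%:R * (7 * eta)) +
  (n%:R ^+ 2 * (M * survival F (n%:R * eta) ^+ 2) + pr P (truncated_excess eta n)).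
Proof.
move=> eta0 hx; set s := x - _.
pose A := [set w | exists2 i, (i < n)%N & s < X i w].
pose B := [set w | exists2 i, (i < n)%N & exists2 j, (j < n)%N &
   i != j /\ n%:R * eta < X i w /\ n%:R * eta < X j w].
pose C := truncated_excess eta n.
have mX k t : measurable [set w | t < X k w].
  by apply: measurable_lt_RV; exact: measurable_RV.
have mA : measurable A by apply: measurable_exists_lt => k; exact: mX.
have mC : measurable C by exact: measurable_truncated_excess.
have mB : measurable B.
  apply: measurable_exists_lt => i; apply: measurable_exists_lt => j.
  have [ij|ij] := eqVneq i j.
    rewrite [X in measurable X](_ : _ = set0)//.
    by apply/seteqP; split => w // [].
  rewrite [X in measurable X](_ : _ = [set w | n%:R * eta < X i w] `&`
    [set w | n%:R * eta < X j w]); first exact: measurableI.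
  by apply/seteqP; split => w [] // ? [].
apply: (@le_trans _ _ (pr P A + (pr P B + pr P C))); last first.
  apply: lerD; first exact: pr_exists_gt_le.
  by rewrite lerD2r; exact: pr_two_le.
apply: (@le_trans _ _ (pr P (A `|` (B `|` C)))); last first.
  apply: (le_trans (prU_le P mA (measurableU _ _ mB mC))).
  by rewrite lerD2l; exact: prU_le.
apply: le_pr.
- by apply: measurable_lt_RV; exact: measurable_sumRV.
- by apply: measurableU => //; exact: measurableU.
move=> w /= h; have [Aw|nAw] := pselect (A w); [by left|right].
have [Bw|nBw] := pselect (B w); [by left|right].
have small i : (i < n)%N -> X i w <= s.
  by move=> ilt; rewrite leNgt; apply/negP => hi; apply: nAw; exists i.
rewrite /C /truncated_excess/=.
have [[i ilt Xi]|nX] := pselect (exists2 i, (i < n)%N & n%:R * eta < X i w).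
  have le_j (j : 'I_n) : j != Ordinal ilt -> X j w = Num.min (X j w) (n%:R * eta).
    move=> ji; rewrite min_l// leNgt; apply/negP => hj; apply: nBw.
    exists i => //; exists j => //; split => //.
    by apply: contra ji => /eqP e; apply/eqP/val_inj.
  have eX : \sum_(j < n) X j w = X i w +
      \sum_(j < n | j != Ordinal ilt) Num.min (X j w) (n%:R * eta).
    by rewrite (bigD1 (Ordinal ilt))//= (eq_bigr _ le_j).
  have eM : \sum_(j < n) Num.min (X j w) (n%:R * eta) = n%:R * eta +
      \sum_(j < n | j != Ordinal ilt) Num.min (X j w) (n%:R * eta).
    by rewrite (bigD1 (Ordinal ilt))//= min_r ?(ltW Xi).
  move: h; rewrite eX eM.
  have := small _ ilt; rewrite /s.
  have : 0 <= n%:R * eta by rewrite mulr_ge0.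
  move: (\sum_(_ < _ | _) _) => S; lra.
suff -> : \sum_(i < n) Num.min (X i w) (n%:R * eta) = \sum_(i < n) X i w.
  by apply: le_lt_trans h; lra.
apply: eq_bigr => i _; rewrite min_l// leNgt; apply/negP => hi; apply: nX.
by exists i.
Qed.

Section lower_lattice.
Variables (eta : R) (eta0 : 0 < eta) (N : nat).

(* the lattice starts at eta, so that the count never overshoots x / eta *)
Let cnt (x : R) : R := (count_above (fun j => j.+1%:R * eta) N x)%:R.

Lemma count_le x : eta * cnt x <= Num.max x 0.
Proof.
apply: le_trans (sum_above_le eta0 N x); rewrite /cnt /count_above.
by rewrite natr_sum mulr_sumr.
Qed.

Lemma count_leN x : cnt x <= N%:R.
Proof.
rewrite /cnt ler_nat /count_above -[leqRHS](card_ord N) -sum1_card.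
by apply: leq_sum => j _; case: (_ < _).
Qed.

(** The count is bounded, so its exponential moment is linear in a small parameter
up to second order, and the first order term sees nearly the whole mean. *)
Lemma pr_count_le eps : 0 < eps ->
  mu - eps / 2 <= \sum_(j < N) eta * survival F (j.+1%:R * eta) ->
  exists2 rho : R, 0 < rho < 1 & forall n, (0 < n)%N ->
    pr P [set w | \sum_(i < n) cnt (X i w) <= n%:R * (mu - eps) / eta] <= M * rho ^+ n.
Proof.
move=> e0; set m := \sum_(j < N) _ => hm.
have mmu : m <= mu by exact: tail_sum_le.
have mu0 := mean_ge0 F0 Fmu.
(* chosen so that theta * N * mu <= eps / 4; the 1 avoids a division by 0 *)
pose theta := eps / (4 * (N%:R * mu + 1)).
have Nmu0 : 0 <= N%:R * mu by rewrite mulr_ge0.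
have den0 : 0 < 4 * (N%:R * mu + 1) by rewrite mulr_gt0// ltr_wpDl.
have th0 : 0 < theta by rewrite divr_gt0.
have thN : theta * (N%:R * mu) <= eps / 4.
  rewrite /theta mulrAC ler_pdivrMr//.
  have := mulr_ge0 (ltW e0) Nmu0; lra.
exists (expR (- (theta / eta * (eps / 4)))).
  rewrite expR_gt0/= expR_lt1 oppr_lt0 mulr_gt0 ?divr_gt0//.
move=> n n0.
have a_le : {homo (fun j => j.+1%:R * eta) : i j / (i <= j)%N >-> i <= j}.
  by move=> i j ij; rewrite ler_pM2r// ler_nat.
apply: (le_trans (chernoff_lower XF XM a_le N _ n0 (ltW th0))).
have M0 := enod_gt0 XM; rewrite -mulrA ler_pM2l//.
pose D (j : nat) := expR (- (theta * j%:R)) - expR (- (theta * j.+1%:R)).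
have mgf : theta / eta * (1 - theta * N%:R) * m <=
    \sum_(j < N) D j * survival F (j.+1%:R * eta).
  rewrite /m mulr_sumr; apply: ler_sum => j _.
  rewrite mulrA ler_wpM2r ?survival_ge0//.
  rewrite (_ : _ * eta = theta * (1 - theta * N%:R)); last by field; rewrite gt_eqF.
  have ltj : (j.+1 <= N)%N by exact: ltn_ord.
  have e1 : 1 - theta * N%:R <= expR (- (theta * j.+1%:R)).
    apply: le_trans (expR_ge1Dx _); rewrite lerD2l lerN2 ler_pM2l// ler_nat//.
  apply: (@le_trans _ _ (theta * expR (- (theta * j.+1%:R)))).
    by rewrite ler_pM2l.
  rewrite /D; have := expR_ge1Dx theta => h1.
  have -> : expR (- (theta * j%:R)) = expR theta * expR (- (theta * j.+1%:R)).
    by rewrite -expRD -natr1; congr expR; ring.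
  have := expR_gt0 (- (theta * j.+1%:R)); move: (expR (- _)) => e e0'.
  have : (1 + theta) * e <= expR theta * e by rewrite ler_pM2r.
  lra.
set S := \sum_(j < N) _ in mgf *.
have S1 : 0 <= 1 - S.
  rewrite subr_ge0; apply: (@le_trans _ _ (\sum_(j < N) D j)).
    apply: ler_sum => j _; rewrite ler_piMr ?survival_le1//.
    by rewrite subr_ge0 ler_expR lerN2 ler_pM2l// ler_nat.
  have -> : \sum_(j < N) D j = 1 - expR (- (theta * N%:R)).
    elim: (N) => [|N' IH]; first by rewrite big_ord0 mulr0 oppr0 expR0 subrr.
    by rewrite big_ord_recr/= IH /D; ring.
  by rewrite gerBl expR_ge0.
have S2 : 1 - S <= expR (- (theta / eta * (1 - theta * N%:R) * m)).
  by apply: le_trans (expR_ge1Dx _); rewrite lerD2l lerN2.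
apply: (@le_trans _ _ (expR (theta * (n%:R * (mu - eps) / eta)) *
   expR (- (theta / eta * (1 - theta * N%:R) * m)) ^+ n)).
  by rewrite ler_pM2l ?expR_gt0//; apply: lerXn2r => //; rewrite nnegrE.
rewrite -!expRM_natl -expRD ler_expR.
have -> : theta * (n%:R * (mu - eps) / eta) +
   n%:R * - (theta / eta * (1 - theta * N%:R) * m) =
   n%:R * (theta / eta * (mu - eps - m + theta * (N%:R * m))) by ring.
rewrite -mulrN ler_pM2l ?ltr0n// -mulrN ler_pM2l ?divr_gt0//.
have : theta * (N%:R * m) <= theta * (N%:R * mu).
  by rewrite ler_pM2l// ler_wpM2l.
lra.
Qed.

End lower_lattice.

Lemma exists_lattice eps : 0 < eps -> exists eta N, 0 < eta /\
  mu - eps / 2 <= \sum_(j < N) eta * survival F (j.+1%:R * eta).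
Proof.
move=> e0; have e4 : 0 < eps / 4 by rewrite divr_gt0.
have [N hN] := tail_sum_ge F0 Fmu e4 e4.
exists (eps / 4), N; split => //; apply: le_trans hN; lra.
Qed.

Lemma pr_sum_le eps : 0 < eps ->
  exists2 rho : R, 0 < rho < 1 & forall n, (0 < n)%N ->
    pr P [set w | \sum_(i < n) X i w <= n%:R * (mu - eps)] <= M * rho ^+ n.
Proof.
move=> e0; have [eta [N [eta0 hN]]] := exists_lattice e0.
have [rho r01 hr] := pr_count_le eta0 e0 hN.
exists rho => // n n0; apply: le_trans (hr n n0).
set A := [set w | _]; set B := [set w | _].
have mB : measurable B.
  by apply: measurable_le_RV; apply: measurable_sum => i; exact: measurable_count.
rewrite -[leRHS]addr0 -(pr_exists_lt0 n).
apply: le_trans (prU_le P mB (measurable_lt0 n)); apply: le_pr.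
- by apply: measurable_le_RV; exact: measurable_sumRV.
- by apply: measurableU => //; exact: measurable_lt0.
move=> w; rewrite /A /B/= => h.
have [ex|nex] := pselect (exists2 i, (i < n)%N & X i w < 0); [by right|left].
rewrite ler_pdivlMr//; apply: le_trans h; rewrite mulr_suml.
apply: ler_sum => i _; rewrite mulrC; apply: (le_trans (count_le eta0 N _)).
rewrite max_l// leNgt; apply/negP => hi; apply: nex; by exists i.
Qed.

(** One large summand suffices as long as the lattice approximation of the whole
sum is not too small: removing one summand from it costs at most [N * eta]. *)
Lemma pr_sum_gt_ge eps : 0 < eps ->
  exists2 rho : R, 0 < rho < 1 & exists2 B : R, 0 <= B & forall n x s, (0 < n)%N ->
    s = survival F (x + n%:R * eps + B) ->
    n%:R * s - n%:R ^+ 2 * (M * s ^+ 2) - M * rho ^+ n <=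
    pr P [set w | n%:R * mu + x < \sum_(i < n) X i w].
Proof.
move=> e0; have [eta [N [eta0 hN]]] := exists_lattice e0.
have [rho r01 hr] := pr_count_le eta0 e0 hN.
exists rho => //; exists (N%:R * eta); first by rewrite mulr_ge0// ltW.
move=> n x s n0 s_eq.
set E := [set w | _].
pose A := [set w | exists2 i, (i < n)%N & x + n%:R * eps + N%:R * eta < X i w].
pose cnt (z : R) : R := (count_above (fun j => j.+1%:R * eta) N z)%:R.
pose B := [set w | \sum_(i < n) cnt (X i w) <= n%:R * (mu - eps) / eta].
pose D := [set w | exists2 i, (i < n)%N & X i w < 0].
have mX k t : measurable [set w | t < X k w].
  by apply: measurable_lt_RV; exact: measurable_RV.
have mA : measurable A by apply: measurable_exists_lt => k; exact: mX.
have mB : measurable B.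
  by apply: measurable_le_RV; apply: measurable_sum => i; exact: measurable_count.
have mE : measurable E by apply: measurable_lt_RV; exact: measurable_sumRV.
have mD : measurable D by exact: measurable_lt0.
have hB : pr P B <= M * rho ^+ n := hr n n0.
have hA : n%:R * s - n%:R ^+ 2 * (M * s ^+ 2) <= pr P A.
  by apply: pr_exists_ge => [i|i|i j ij]; [exact: mX|rewrite s_eq; exact: pr_gt_law (XF i)|rewrite s_eq; exact: pr_pair_le].
suff : pr P A <= pr P E + (pr P B + pr P D).
  by rewrite [pr P D]pr_exists_lt0; lra.
apply: (@le_trans _ _ (pr P (E `|` (B `|` D)))); last first.
  apply: (le_trans (prU_le P mE (measurableU _ _ mB mD))).
  by rewrite lerD2l; exact: prU_le.
apply: le_pr => //; first by apply: measurableU => //; exact: measurableU.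
move=> w [i ilt Xi].
have [Bw|nBw] := pselect (B w); first by right; left.
have [Dw|nDw] := pselect (D w); first by right; right.
left; rewrite /E/=.
have cX (j : 'I_n) : eta * cnt (X j w) <= X j w.
  apply: (le_trans (count_le eta0 N _)).
  rewrite max_l// leNgt; apply/negP => hi; apply: nDw; by exists j.
have : n%:R * (mu - eps) < \sum_(j < n) eta * cnt (X j w).
  by rewrite -mulr_sumr [ltRHS]mulrC -ltr_pdivrMr// ltNge; apply/negP; exact: nBw.
have eX : \sum_(j < n) X j w = X i w + \sum_(j < n | j != Ordinal ilt) X j w.
  by rewrite (bigD1 (Ordinal ilt)).
have eC : \sum_(j < n) eta * cnt (X j w) = eta * cnt (X i w) +
    \sum_(j < n | j != Ordinal ilt) eta * cnt (X j w).
  by rewrite (bigD1 (Ordinal ilt)).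
rewrite eX eC.
have h1 : \sum_(j < n | j != Ordinal ilt) eta * cnt (X j w) <=
   \sum_(j < n | j != Ordinal ilt) X j w by apply: ler_sum => j _; exact: cX.
have h2 : eta * cnt (X i w) <= N%:R * eta.
  by rewrite mulrC ler_pM2r//; exact: count_leN.
move: h1 h2 Xi; move: (\sum_(_ < _ | _) _) (\sum_(_ < _ | _) _) => a b; lra.
Qed.

End sums.

(** * Precise large deviations along sequences *)

Section negligible.
Context {R : realType}.
Variable g : R -> R.

(** One-sided, since the error terms are probabilities. *)
Definition negligible_to (e : nat -> R) := forall eps : R, 0 < eps ->
  \forall n \near \oo, e n <= eps * (n%:R * g n%:R).

Lemma negligible_toD e1 e2 : negligible_to e1 -> negligible_to e2 ->
  negligible_to (fun n => e1 n + e2 n).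
Proof.
move=> h1 h2 eps e0; have e20 : 0 < eps / 2 by rewrite divr_gt0.
near=> n.
have : e1 n <= eps / 2 * (n%:R * g n%:R) by near: n; exact: h1.
have : e2 n <= eps / 2 * (n%:R * g n%:R) by near: n; exact: h2.
lra.
Unshelve. all: by end_near. Qed.

Lemma negligible_to_le e1 e2 : (\forall n \near \oo, e1 n <= e2 n) ->
  negligible_to e2 -> negligible_to e1.
Proof.
move=> h1 h2 eps e0; near=> n; apply: (@le_trans _ _ (e2 n)).
  by near: n; exact: h1.
by near: n; exact: h2.
Unshelve. all: by end_near. Qed.

Hypotheses (g_le : {homo g : x y /~ x <= y}) (gC : consistent g).
Hypothesis g_cvg0 : forall eta eps : R, 0 < eta -> 0 < eps ->
  \forall n \near \oo, n%:R * g (n%:R * eta) <= eps.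

(** One of the two factors is comparable to [n * g n], the other tends to [0]. *)
Lemma negligible_to_sqr C eta : 0 < eta ->
  negligible_to (fun n => C * (n%:R * g (n%:R * eta)) ^+ 2).
Proof.
move=> eta0 eps e0; have g0 := consistent_gt0 g_le gC.
have [C1 [t0 [C10 t00 hC]]] := consistent_comparable g_le gC eta0 ltr01.
pose dl := eps / ((`|C| + 1) * C1).
have C'0 : 0 < `|C| + 1 by rewrite ltr_wpDl.
have dl0 : 0 < dl by rewrite divr_gt0// mulr_gt0.
near=> n.
have nt : t0 <= n%:R by near: n; exact: nbhs_infty_ger.
have hd : n%:R * g (n%:R * eta) <= dl by near: n; exact: g_cvg0.
have := hC _ nt; rewrite mul1r mulrC => hg.
have q0 : 0 <= n%:R * g (n%:R * eta) by rewrite mulr_ge0// ltW.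
apply: (@le_trans _ _ ((`|C| + 1) * (dl * (n%:R * (C1 * g n%:R))))).
  apply: (@le_trans _ _ ((`|C| + 1) * (n%:R * g (n%:R * eta)) ^+ 2)).
    rewrite ler_wpM2r ?exprn_ge0//; apply: (le_trans (ler_norm C)).
    by rewrite lerDl.
  rewrite ler_pM2l// expr2; apply: ler_pM => //.
  by rewrite ler_wpM2l.
rewrite /dl le_eqVlt; apply/orP; left; apply/eqP; field.
by rewrite !gt_eqF.
Unshelve. all: by end_near. Qed.

Lemma negligible_to_expr C rho : 0 <= C -> 0 < rho < 1 ->
  negligible_to (fun n => C * rho ^+ n).
Proof.
move=> C0 r01 eps e0; have g0 := consistent_gt0 g_le gC.
have C'0 : 0 < C + 1 by rewrite ltr_wpDl.
have := consistent_expr g_le gC r01 (divr_gt0 e0 C'0).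
move=> h; near=> n.
have n1 : 1 <= n%:R :> R by rewrite ler1n; near: n; exact: nbhs_infty_gt.
have : rho ^+ n <= eps / (C + 1) * g n%:R by near: n; exact: h.
move=> hn; have r0 : 0 <= rho ^+ n by case/andP: r01 => /ltW *; rewrite exprn_ge0.
apply: (@le_trans _ _ ((C + 1) * rho ^+ n)); first by rewrite ler_wpM2r// lerDl.
rewrite -ler_pdivlMl//; apply: (le_trans hn).
by rewrite -mulrA mulrCA ler_pM2l ?invr_gt0// ler_pM2l// ler_peMl// ltW.
Unshelve. all: by end_near. Qed.

Lemma negligible_to_littleo (h : R -> R) eta : 0 < eta ->
  (forall eps, 0 < eps -> exists x1, forall x, x1 <= x -> h x <= eps * g x) ->
  negligible_to (fun n => n%:R * h (n%:R * eta)).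
Proof.
move=> eta0 ho eps e0.
have [C1 [t0 [C10 t00 hC]]] := consistent_comparable g_le gC eta0 ltr01.
have [x1 hx1] := ho _ (divr_gt0 e0 C10).
near=> n.
have nt : t0 <= n%:R by near: n; exact: nbhs_infty_ger.
have nx : x1 <= n%:R * eta.
  by rewrite -ler_pdivrMr//; near: n; exact: nbhs_infty_ger.
have := hC _ nt; rewrite mul1r mulrC => hg.
rewrite mulrCA ler_wpM2l//; apply: (le_trans (hx1 _ nx)).
by rewrite mulrAC ler_pdivrMr// -mulrA [g _ * _]mulrC ler_pM2l.
Unshelve. all: by end_near. Qed.

End negligible.

Section large_deviations.
Context {d : measure_display} {T : measurableType d} {R : realType}.
Variables (P : probability T R) (F : probability R R).
Variables (X : nat -> {RV P >-> R}) (M mu : R) (g : R -> R).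
Hypotheses (XF : forall i, has_law (X i) F) (XM : enod X M).
Hypotheses (F0 : nonneg_law F) (Fmu : has_mean F mu).
Hypotheses (g_le : {homo g : x y /~ x <= y}) (gC : consistent g).
Hypothesis g_cvg0 : forall eta eps : R, 0 < eta -> 0 < eps ->
  \forall n \near \oo, n%:R * g (n%:R * eta) <= eps.
Hypothesis Fg : exists x1, forall x, x1 <= x -> survival F x <= g x.

Lemma truncated_excess_negligible eta : 0 < eta ->
  negligible_to g (fun n => pr P (truncated_excess X mu eta n)).
Proof.
move=> eta0; have [C hC] := truncated_sum_le XF XM F0 Fmu g_le gC g_cvg0 Fg eta0.
apply: negligible_to_le (negligible_to_sqr g_le gC g_cvg0 C eta0).
near=> n; apply: (le_trans (pr_truncated_excess_le X mu n eta0)).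
by near: n; exact: hC.
Unshelve. all: by end_near. Qed.

(** Upper deviations of arrival times: the tail of [F] is negligible, so that the
crude bound suffices. *)
Lemma sum_gt_negligible dl : 0 < dl ->
  (forall eps, 0 < eps -> exists x1, forall x, x1 <= x ->
     survival F x <= eps * g x) ->
  negligible_to g (fun n => pr P [set w | n%:R * (mu + dl) < \sum_(i < n) X i w]).
Proof.
move=> dl0 ho; have eta0 : 0 < dl / 7 by rewrite divr_gt0.
apply: negligible_to_le (negligible_toD (negligible_to_littleo g_le gC eta0 ho)
  (truncated_excess_negligible eta0)).
near=> n; rewrite (_ : mu + dl = mu + 7 * (dl / 7)); last by field.
exact/pr_sum_gt_crude/ltW.
Unshelve. all: by end_near. Qed.

Lemma sum_le_negligible dl : 0 < dl ->
  negligible_to g (fun n => pr P [set w | \sum_(i < n) X i w <= n%:R * (mu - dl)]).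
Proof.
move=> dl0; have [rho r01 hr] := pr_sum_le XF XM F0 Fmu dl0.
apply: negligible_to_le (negligible_to_expr g_le gC (ltW (enod_gt0 XM)) r01).
near=> n; apply: hr; near: n; exact: nbhs_infty_gt.
Unshelve. all: by end_near. Qed.

Lemma sum_gt_upper eta : 0 < eta -> exists2 e, negligible_to g e &
  forall n x, n%:R * (7 * eta) <= x ->
    pr P [set w | n%:R * mu + x < \sum_(i < n) X i w] <=
    n%:R * survival F (x - n%:R * (7 * eta)) + e n.
Proof.
move=> eta0; exists (fun n => n%:R ^+ 2 * (M * survival F (n%:R * eta) ^+ 2) +
  pr P (truncated_excess X mu eta n)); last first.
  by move=> n x hx; exact: pr_sum_gt_le (ltW eta0) hx.
apply: negligible_toD (truncated_excess_negligible eta0).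
apply: negligible_to_le (negligible_to_sqr g_le gC g_cvg0 M eta0).
have [x1 hx1] := Fg; near=> n.
have nx : x1 <= n%:R * eta.
  by rewrite -ler_pdivrMr//; near: n; exact: nbhs_infty_ger.
rewrite mulrCA ler_pM2l ?(enod_gt0 XM)// exprMn ler_wpM2l ?exprn_ge0//.
have g0 := consistent_gt0 g_le gC.
by apply: lerXn2r; rewrite ?nnegrE ?survival_ge0 ?hx1// ltW.
Unshelve. all: by end_near. Qed.

Lemma sum_gt_lower eps : 0 < eps -> exists2 e, negligible_to g e &
  exists2 B : R, 0 <= B & forall n x s, (0 < n)%N ->
    s = survival F (x + n%:R * eps + B) ->
    n%:R * s - n%:R ^+ 2 * (M * s ^+ 2) - e n <=
    pr P [set w | n%:R * mu + x < \sum_(i < n) X i w].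
Proof.
move=> e0; have [rho r01 hr] := pr_sum_gt_ge XF XM F0 Fmu e0.
exists (fun n => M * rho ^+ n); last exact: hr.
apply: negligible_to_expr => //; exact: ltW (enod_gt0 XM).
Qed.

End large_deviations.

(** * Reduction of ruin to sums with a fixed number of terms *)

Lemma le_sum_ord (R : realType) (u : nat -> R) m n : (forall i, 0 <= u i) ->
  (m <= n)%N -> \sum_(i < m) u i <= \sum_(i < n) u i.
Proof.
move=> u0 mn; rewrite -[n in leRHS](subnKC mn) big_split_ord/= lerDl.
exact: sumr_ge0.
Qed.

Section ruin.
Context {d : measure_display} {T : measurableType d} {R : realType}.
Variables (P : probability T R) (Y Z : nat -> {RV P >-> R}) (c : R).

Let SZ n w := \sum_(i < n) Z i w.
Let arrived t k : set T := [set v | SZ k v <= t].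

Lemma measurable_arrived t k : measurable (arrived t k).
Proof. by apply: measurable_le_RV; exact: measurable_sumRV. Qed.

Lemma measurable_renewal_count t : measurable_fun setT (renewal_count Z t).
Proof.
apply: (@emeasurable_fun_cvg _ _ _ _
  (fun m w => (\sum_(1 <= k < m) (\1_(arrived t k) w)%:E)%E)).
- move=> m; apply: emeasurable_sum => k; apply/measurable_EFinP.
  by apply: measurable_indic; exact: measurable_arrived.
- by move=> w _; apply: is_cvg_nneseries.
Qed.

Lemma measurable_renewal_count_ge t n :
  measurable [set w | (n%:R%:E <= renewal_count Z t w)%E].
Proof.
have := emeasurable_fun_c_infty measurableT (measurable_renewal_count t) n%:R%:E.
by rewrite setTI.
Qed.

Lemma ruinP t x w : (x%:E < max_claim_surplus Y Z c t w)%E <->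
  exists n, (n%:R%:E <= renewal_count Z t w)%E /\ x < claim_surplus Y Z c n w.
Proof.
split.
  by move=> /ereal_sup_gt[_ [n hn <-]]; rewrite lte_fin => h; exists n.
move=> [n [hn h]]; apply: (@lt_le_trans _ _ (claim_surplus Y Z c n w)%:E).
  by rewrite lte_fin.
by apply: ereal_sup_ubound; exists n.
Qed.

Lemma measurable_claim_surplus n : measurable_fun setT (claim_surplus Y Z c n).
Proof.
apply: measurable_sum => i; apply: measurable_funB; first exact: measurable_RV.
by apply: measurable_funM => //; exact: measurable_RV.
Qed.

Lemma measurable_ruin t x :
  measurable [set w | (x%:E < max_claim_surplus Y Z c t w)%E].
Proof.
have mI n : measurable ([set w | (n%:R%:E <= renewal_count Z t w)%E] `&`
    [set w | x < claim_surplus Y Z c n w]).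
  apply: measurableI; first exact: measurable_renewal_count_ge.
  by apply: measurable_lt_RV; exact: measurable_claim_surplus.
have := measurable_exists mI; congr measurable.
by apply/seteqP; split => w /ruinP.
Qed.

Section nonnegative.
Variable w : T.
Hypothesis Z0 : forall i, 0 <= Z i w.

Lemma le_sumZ m n : (m <= n)%N -> SZ m w <= SZ n w.
Proof. exact: (le_sum_ord (u := fun i => Z i w)). Qed.

(** The arrival times are nondecreasing, so the terms counted by the series are the
first ones. *)
Lemma renewal_count_ge n t : (0 < n)%N ->
  (n%:R%:E <= renewal_count Z t w)%E <-> SZ n w <= t.
Proof.
move=> n0; split => [|h]; last first.
  apply: le_trans (nneseries_lim_ge n.+1 _) => //.
  rewrite sumEFin lee_fin (eq_big_nat _ _ (F2 := fun=> 1)).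
    by rewrite sumr_const_nat subSS subn0.
  move=> k /andP[_]; rewrite ltnS => kn; rewrite indicE mem_set//=.
  by apply: le_trans h; exact: le_sumZ.
move=> h; rewrite leNgt; apply/negP => tn; move: h; apply/negP; rewrite -ltNge.
suff : (renewal_count Z t w <= n.-1%:R%:E)%E.
  by move=> /le_lt_trans; apply; rewrite lte_fin ltr_nat prednK.
apply: lime_le; first exact: is_cvg_nneseries.
apply: nearW => m; rewrite sumEFin lee_fin.
apply: (@le_trans _ _ (minn m.-1 n.-1)%:R); last by rewrite ler_nat geq_minr.
case: m => [|m] /=; first by rewrite big_geq.
elim: m => [|m IH]; first by rewrite big_geq.
rewrite big_nat_recr//= indicE.
have [mn|mn] := ltnP m.+1 n.
  apply: (@le_trans _ _ ((minn m n.-1)%:R + 1)).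
    by apply: lerD IH _; case: (_ \in _).
  by rewrite natr1 ler_nat; lia.
rewrite memNset ?addr0; first by apply: (le_trans IH); rewrite ler_nat; lia.
move=> /= hm; move: tn; apply/negP; rewrite -leNgt; apply: le_trans hm.
exact: le_sumZ.
Qed.

End nonnegative.

Variables (G H : probability R R).
Hypotheses (YG : forall i, has_law (Y i) G) (G0 : nonneg_law G).
Hypotheses (ZH : forall i, has_law (Z i) H) (H0 : nonneg_law H).

Lemma pr_lt0_law (X : nat -> {RV P >-> R}) (F : probability R R) :
  (forall i, has_law (X i) F) -> nonneg_law F ->
  measurable [set w | exists i, X i w < 0] /\
  pr P [set w | exists i, X i w < 0] = 0.
Proof.
move=> XF F0.
have mX i : measurable [set w | X i w < 0].
  by apply: measurable_gt_RV; exact: measurable_RV.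
have mE : measurable [set w | exists i, X i w < 0] by exact: measurable_exists.
split => //; apply/eqP; rewrite eq_le pr_ge0 andbT -lee_fin -prE//.
rewrite (_ : [set w | _] = \bigcup_i [set w | X i w < 0]); last first.
  by apply/seteqP; split => w [i]; exists i.
apply: le_trans (generalized_Boole_inequality P mX _) _.
  exact: bigcupT_measurable.
rewrite eseries0// => i _ _.
by rewrite -F0 -(XF i)//; congr (P _); apply/seteqP; split => w /=; rewrite in_itv.
Qed.

Let bad := [set w | exists i, Y i w < 0] `|` [set w | exists i, Z i w < 0].

Lemma measurable_bad : measurable bad.
Proof.
by apply: measurableU; [have [] := pr_lt0_law YG G0|have [] := pr_lt0_law ZH H0].
Qed.

Lemma pr_bad : pr P bad = 0.
Proof.
have [mY PY] := pr_lt0_law YG G0; have [mZ PZ] := pr_lt0_law ZH H0.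
by apply/eqP; rewrite eq_le pr_ge0 andbT (le_trans (prU_le P mY mZ))// PY PZ addr0.
Qed.

Lemma notbadP w : ~ bad w -> (forall i, 0 <= Y i w) /\ (forall i, 0 <= Z i w).
Proof.
move=> nb; split=> i; rewrite leNgt; apply/negP => h; apply: nb.
  by left; exists i.
by right; exists i.
Qed.

(** Up to the [n]-th arrival the surplus is at most the sum of the first [n]
claims, and later arrivals are excluded unless the [n]-th one comes by time [t]. *)
Lemma ruin_prob_le n t x : 0 <= c -> ruin_prob Y Z c x t <=
  pr P [set w | \sum_(i < n) Z i w <= t] + pr P [set w | x < \sum_(i < n) Y i w].
Proof.
move=> c0; set A := [set w | _ <= t]; set B := [set w | _ < _].
have mA : measurable A by exact: measurable_arrived.
have mB : measurable B by apply: measurable_lt_RV; exact: measurable_sumRV.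
have mC := measurable_bad.
apply: (@le_trans _ _ (pr P ((A `|` B) `|` bad))); last first.
  apply: (le_trans (prU_le P (measurableU _ _ mA mB) mC)).
  by rewrite pr_bad addr0; exact: prU_le.
apply: le_pr; first exact: measurable_ruin.
  by apply: measurableU => //; exact: measurableU.
move=> w /ruinP[k [hk hx]]; have [bw|/notbadP[Y0 Z0]] := pselect (bad w); first by right.
left; have [kn|nk] := leqP k n.
  right; rewrite /B/=; apply: (lt_le_trans hx); rewrite /claim_surplus.
  rewrite sumrB -mulr_sumr; apply: le_trans (le_sum_ord Y0 kn).
  by rewrite gerBl mulr_ge0// sumr_ge0.
left; rewrite /A/=; apply: (@le_trans _ _ (SZ k w)); first exact/le_sumZ/ltnW.
by apply/renewal_count_ge => //; exact: leq_ltn_trans nk.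
Qed.

(** If the [n]-th arrival comes by time [t], at most [c * t] of premium income
has been collected by then. *)
Lemma ruin_prob_ge n t x : (0 < n)%N -> 0 <= c ->
  pr P [set w | x + c * t < \sum_(i < n) Y i w] -
  pr P [set w | t < \sum_(i < n) Z i w] <= ruin_prob Y Z c x t.
Proof.
move=> n0 c0; rewrite lerBlDr.
set A := [set w | x + _ < _]; set B := [set w | t < _].
have mA : measurable A by apply: measurable_lt_RV; exact: measurable_sumRV.
have mB : measurable B by apply: measurable_lt_RV; exact: measurable_sumRV.
have mC := measurable_bad.
set D := [set w | (x%:E < max_claim_surplus Y Z c t w)%E].
have mD : measurable D by exact: measurable_ruin.
apply: (@le_trans _ _ (pr P ((D `|` B) `|` bad))); last first.
  apply: (le_trans (prU_le P (measurableU _ _ mD mB) mC)).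
  by rewrite pr_bad addr0; exact: prU_le.
apply: le_pr => //; first by apply: measurableU => //; exact: measurableU.
move=> w Aw; have [bw|/notbadP[Y0 Z0]] := pselect (bad w); first by right.
left; have [tn|tn] := ltP t (SZ n w); [by right|left].
apply/ruinP; exists n; split; first exact/renewal_count_ge.
rewrite /claim_surplus sumrB -mulr_sumr; move: Aw; rewrite /A/=.
have : c * SZ n w <= c * t by rewrite ler_wpM2l.
rewrite /SZ; lra.
Qed.

End ruin.

(** * Asymptotics of the ruin probability *)

(** Transfer from the index [n] to the time [t]: when [n] is of order [t] and [y] is
at most of order [t], comparability turns [o (n * g n)] into [o (t * g y)]. *)
Lemma negligible_to_time (R : realType) (g : R -> R) (e : nat -> R) (a b k : R) :
  {homo g : x y /~ x <= y} -> consistent g -> negligible_to g e ->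
  0 < a -> 0 < b -> 0 < k -> forall eps, 0 < eps ->
  \forall t \near +oo, forall n y, a * t <= n%:R -> n%:R <= b * t -> y <= k * t ->
    e n <= eps * (t * g y).
Proof.
move=> g_le gC eneg a0 b0 k0 eps eps0; have g0 := consistent_gt0 g_le gC.
have [C [t0 [C0 t00 hC]]] := consistent_comparable g_le gC a0 k0.
have [N _ hN] := eneg _ (divr_gt0 eps0 (mulr_gt0 b0 C0)).
near=> t.
have tt0 : t0 <= t by near: t; apply: nbhs_pinfty_ge; exact: num_real.
have tN : N%:R / a <= t by near: t; apply: nbhs_pinfty_ge; exact: num_real.
have t_gt0 : 0 < t by rewrite (lt_le_trans t00).
move=> n y hn1 hn2 hy.
have Nn : (N <= n)%N.
  by rewrite -(ler_nat R); apply: le_trans hn1; rewrite mulrC -ler_pdivrMr.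
apply: (le_trans (hN n Nn)).
have gn : g n%:R <= C * g y.
  apply: (@le_trans _ _ (C * g (k * t))); last by rewrite ler_pM2l//; exact: g_le.
  by apply: le_trans (hC _ tt0); exact: g_le.
have h : n%:R * g n%:R <= b * t * (C * g y) by apply: ler_pM => //; exact: ltW (g0 _).
apply: (le_trans (ler_wpM2l _ h)).
  by rewrite ltW// divr_gt0// mulr_gt0.
by rewrite le_eqVlt; apply/orP; left; apply/eqP; field; rewrite !gt_eqF.
Unshelve. all: by end_near. Qed.

(** With [v] the inverse of the mean [h], the index is about [v * t], and [n] waiting
times of length [h - dl] take at least the time [t]. *)
Lemma index_above (R : realType) (h v dl e t : R) : h * v = 1 -> 0 < v ->
  0 < dl -> dl * v <= e / 4 -> e <= 1 -> 0 < t -> 2 <= t * (e * v) ->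
  exists n : nat, [/\ t <= n%:R * (h - dl), v * t <= n%:R,
    n%:R <= v * t + 2 * (dl * v) * (v * t) + 1 & n%:R <= (1 + e) * (v * t)].
Proof.
move=> hv v0 dl0 dlv e1 t0 t2.
have tv0 : 0 < v * t by rewrite mulr_gt0.
have z0 : 0 < dl * v by rewrite mulr_gt0.
have hdl : 0 < h - dl by rewrite -(pmulr_lgt0 _ v0) mulrBl hv; lra.
have inv_le : (h - dl)^-1 <= v * (1 + 2 * (dl * v)).
  rewrite -[leLHS]mul1r ler_pdivrMr//.
  have -> : v * (1 + 2 * (dl * v)) * (h - dl) =
     (h * v) * (1 + 2 * (dl * v)) - dl * v * (1 + 2 * (dl * v)) by ring.
  rewrite hv; move: (dl * v) z0 dlv => z; clear -e1; nra.
pose n := (Num.trunc (t / (h - dl))).+1.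
have n_gt : t < n%:R * (h - dl) by rewrite -ltr_pdivrMr//; exact: truncnS_gt.
have n_le : n%:R <= t / (h - dl) + 1.
  have tq0 : 0 <= t / (h - dl) by rewrite divr_ge0// ltW.
  by rewrite -natr1 lerD2r; have /andP[] := truncn_itv tq0.
have f1 : n%:R <= v * t + 2 * (dl * v) * (v * t) + 1.
  apply: (le_trans n_le); rewrite lerD2r.
  have := ler_wpM2l (ltW t0) inv_le; lra.
exists n; split => //; first exact: ltW.
  have h0 : 0 < h by rewrite -(pmulr_lgt0 _ v0) hv ltr01.
  rewrite -(ler_pM2l h0) mulrA hv mul1r mulrC; apply: (le_trans (ltW n_gt)).
  by rewrite ler_wpM2l// gerDl oppr_le0 ltW.
have : 2 * (dl * v) * (v * t) <= e / 2 * (v * t).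
  by rewrite ler_wpM2r ?(ltW tv0)//; lra.
lra.
Qed.

(** Dual to [index_above], with an index at which the [n]-th arrival time, with mean
waiting time raised by [dl], is still at most [t]. *)
Lemma index_below (R : realType) (h v dl e t : R) : h * v = 1 -> 0 < v ->
  0 < dl -> dl * v <= e / 2 -> 0 < t -> 2 <= t * (e * v) ->
  exists n : nat, [/\ n%:R * (h + dl) <= t, n%:R <= v * t,
    v * t - dl * v * (v * t) - 1 <= n%:R & (1 - e) * (v * t) <= n%:R].
Proof.
move=> hv v0 dl0 dlv t0 t2.
have h0 : 0 < h by rewrite -(pmulr_lgt0 _ v0) hv ltr01.
have hdl : 0 < h + dl by rewrite addr_gt0.
have tv0 : 0 < v * t by rewrite mulr_gt0.
have tq0 : 0 <= t / (h + dl) by rewrite divr_ge0// ltW.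
have /andP[] := truncn_itv tq0; set n := Num.trunc _ => n_le n_gt.
have inv_ge : v * (1 - dl * v) <= (h + dl)^-1.
  rewrite -[leRHS]mul1r ler_pdivlMr//.
  have -> : v * (1 - dl * v) * (h + dl) =
     (h * v) * (1 - dl * v) + dl * v * (1 - dl * v) by ring.
  rewrite hv; have : 0 <= (dl * v) * (dl * v) by rewrite mulr_ge0// mulr_ge0// ltW.
  lra.
have f1 : v * t - dl * v * (v * t) - 1 <= n%:R.
  move: n_gt; rewrite -natr1; have := ler_wpM2l (ltW t0) inv_ge; lra.
exists n; split => //; first by rewrite -ler_pdivlMr.
  apply: (le_trans n_le); rewrite mulrC ler_pM2r// -[leRHS]mul1r -hv.
  rewrite -[leLHS]mul1r ler_pdivrMr// mulrAC hv mul1r mulrC.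
  by rewrite mulrDr [v * h]mulrC hv lerDl mulr_ge0// ltW.
have : dl * v * (v * t) <= e / 2 * (v * t) by rewrite ler_wpM2r ?(ltW tv0).
lra.
Qed.

(** Centering at [n * m] instead of [m * v * t], and the margin [7 * dl] of the
large deviation bound, move the level [y] by [O(dl * t)] only, which is at most a
fixed fraction of [y]. *)
Lemma level_above (R : realType) (m v dl t x yC k n : R) :
  let A := 2 * m * v ^+ 2 + 14 * v in let y := x - m * v * t in
  0 <= m -> 0 < dl -> 0 <= t -> 0 <= 1 - yC^-1 ->
  n <= v * t + 2 * (dl * v) * (v * t) + 1 -> n <= 2 * v * t ->
  m + 7 * dl <= t * (dl * A) -> 2 * A * dl <= (1 - yC^-1) * k -> k * t <= y ->
  y / yC <= x - n * m - n * (7 * dl).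
Proof.
move=> A y m0 dl0 t0 yC0 n1 n2 tA Ak ky.
have h1 : n * m <= (v * t + 2 * (dl * v) * (v * t) + 1) * m by rewrite ler_wpM2r.
have h2 : n * (7 * dl) <= (2 * v * t + 1) * (7 * dl).
  by rewrite ler_wpM2r ?mulr_ge0 ?(ltW dl0)//; lra.
have h3 : 2 * A * dl * t <= (1 - yC^-1) * y.
  apply: (le_trans (ler_wpM2r t0 Ak)); rewrite -mulrA.
  by rewrite ler_wpM2l.
rewrite mulrBl mul1r [yC^-1 * y]mulrC in h3.
have h4 : 2 * A * dl * t = 2 * (t * (dl * A)) by ring.
have h5 : t * (dl * A) = 2 * (dl * v) * (v * t) * m + 2 * v * t * (7 * dl).
  by rewrite /A; ring.
have h6 : y = x - v * t * m by rewrite /y; ring.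
rewrite h4 in h3; move: h1 h2 h3 tA h5 h6.
move: (t * (dl * A)) (2 * (dl * v) * (v * t)) y {Ak ky h4} => q p y.
by clear; lra.
Qed.

Lemma level_below (R : realType) (m v dl t x B yC k n : R) :
  let A := m * v ^+ 2 + v in let y := x - m * v * t in
  0 <= m -> 0 < dl -> 0 <= t -> 0 <= yC - 1 ->
  v * t - dl * v * (v * t) - 1 <= n -> n <= v * t ->
  m + B <= t * (dl * A) -> 2 * A * dl <= (yC - 1) * k -> k * t <= y ->
  x - n * m + n * dl + B <= y * yC.
Proof.
move=> A y m0 dl0 t0 yC0 n1 n2 tA Ak ky.
have h1 : (v * t - dl * v * (v * t) - 1) * m <= n * m by rewrite ler_wpM2r.
have h2 : n * dl <= v * t * dl by rewrite ler_wpM2r// ltW.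
have h3 : 2 * A * dl * t <= (yC - 1) * y.
  apply: (le_trans (ler_wpM2r t0 Ak)); rewrite -mulrA.
  by rewrite ler_wpM2l.
have h4 : 2 * A * dl * t = 2 * (t * (dl * A)) by ring.
have h5 : t * (dl * A) = dl * v * (v * t) * m + v * t * dl by rewrite /A; ring.
have h6 : y = x - v * t * m by rewrite /y; ring.
rewrite h4 in h3; move: h1 h2 h3 tA h5 h6.
move: (t * (dl * A)) (dl * v * (v * t)) y {Ak ky h4} => q p y.
by clear; lra.
Qed.

(** Final bookkeeping: [a] and [b] stand for the probabilities of an early arrival
and of a large sum of claims, [u] for the expected number of claims. *)
Lemma combine_above (R : realType) (e eps a b n u gy : R) : 0 <= e -> 5 * e <= eps ->
  5 * e <= 1 -> 0 <= u -> 0 <= gy -> n <= (1 + e) * u ->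
  a <= e * (u * gy) -> b <= n * ((1 + e) * gy) + e * (u * gy) ->
  a + b <= (1 + eps) * (u * gy).
Proof.
move=> e0 e1 e2 u0 gy0 nu ha hb.
have h1 : n * ((1 + e) * gy) <= (1 + e) * u * ((1 + e) * gy).
  by rewrite ler_wpM2r// mulr_ge0//; lra.
have h2 : ((1 + e) * (1 + e) + 2 * e) * (u * gy) <= (1 + eps) * (u * gy).
  by rewrite ler_wpM2r ?mulr_ge0//; clear -e0 e1 e2; nra.
lra.
Qed.

(** As in [combine_above]; [s] is the tail at the perturbed level, [M'] the
contribution of pairs of large claims, and [err] the negligible error. *)
Lemma combine_below (R : realType) (e eps a b n u gy s M' err : R) : 0 <= e ->
  5 * e <= eps -> 5 * e <= 1 -> 0 <= u -> 0 <= gy -> 0 <= s ->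
  (1 - e) * u <= n -> gy <= (1 + e) * s -> M' <= e * (n * s) ->
  err <= e * (u * gy) -> b <= e * (u * gy) -> n * s - M' - err <= a ->
  (1 - eps) * (u * gy) <= a - b.
Proof.
move=> e0 e1 e2 u0 gy0 s0 nu gys hM herr hb ha.
have e3 : 0 <= 1 - e by lra.
have h1 : (1 - e) * gy <= s.
  have := ler_wpM2l e3 gys; have : 0 <= e * e * s by rewrite !mulr_ge0.
  clear; lra.
have h2 : (1 - e) * u * ((1 - e) * gy) <= n * s.
  by apply: ler_pM => //; rewrite mulr_ge0.
have h3 := ler_wpM2l e3 h2.
have h4 : (1 - eps) * (u * gy) <=
    ((1 - e) * ((1 - e) * (1 - e)) - 2 * e) * (u * gy).
  rewrite ler_wpM2r ?mulr_ge0//.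
  have : 0 <= e * e * (3 - e) by rewrite mulr_ge0 ?mulr_ge0//; lra.
  clear -e1; lra.
move: h3 h4 hM herr hb ha; clear; lra.
Qed.

Section ruin_asymptotics.
Context {d : measure_display} {T : measurableType d} {R : realType}.
Variables (P : probability T R) (Y Z : nat -> {RV P >-> R}).
Variables (G H : probability R R) (muG muH c MG MH gamma Gamma : R).
Hypotheses (YG : forall i, has_law (Y i) G) (G0 : nonneg_law G).
Hypotheses (Gmu : has_mean G muG) (muG_gt0 : 0 < muG).
Hypotheses (ZH : forall i, has_law (Z i) H) (H0 : nonneg_law H).
Hypotheses (Hmu : has_mean H muH) (muH_gt0 : 0 < muH).
Hypotheses (c0 : 0 < c) (Yenod : enod Y MG) (Zenod : enod Z MH).
Hypothesis GC : consistent (survival G).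
Hypothesis HG : forall eps, 0 < eps -> exists x1, forall x, x1 <= x ->
  survival H x <= eps * survival G x.
Hypotheses (gamma_gt : muH^-1 * muG < gamma) (Gamma_gt : gamma < Gamma).

Let g := survival G.
Let v := muH^-1.

Let g_le : {homo g : x y /~ x <= y}. Proof. exact: survival_le. Qed.
Let g0 x : 0 < g x. Proof. exact: consistent_gt0 g_le GC x. Qed.

Let g_cvg0 (eta eps : R) : 0 < eta -> 0 < eps ->
  \forall n \near \oo, n%:R * g (n%:R * eta) <= eps.
Proof. by move=> *; exact: (survival_mul_cvg0 G0 Gmu). Qed.

Let GG : exists x1, forall x, x1 <= x -> survival G x <= g x.
Proof. by exists 0. Qed.

Let HG1 : exists x1, forall x, x1 <= x -> survival H x <= g x.
Proof.
have [x1 h] := HG ltr01; exists x1 => x /h; by rewrite mul1r.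
Qed.

Let v0 : 0 < v. Proof. by rewrite invr_gt0. Qed.
Let muHv : muH * v = 1. Proof. by rewrite mulfV// gt_eqF. Qed.

Lemma small_margin (eps : R) : 0 < eps ->
  exists e1, [/\ 0 < e1, 5 * e1 <= eps & 5 * e1 <= 1].
Proof.
move=> eps0; exists (Num.min eps 1 / 5); split.
- by rewrite divr_gt0// lt_min eps0 ltr01.
- by rewrite mulrC divfK// ge_min lexx.
- by rewrite mulrC divfK// ge_min lexx orbT.
Qed.

(** The level here does not contain [c * t]: the premium income has been dropped. *)
Lemma ruin_prob_upper eps : 0 < eps -> \forall t \near +oo, forall x,
  gamma * t <= x -> x <= Gamma * t ->
  ruin_prob Y Z c x t <= (1 + eps) * (v * t * g (x - muG * v * t)).
Proof.
move=> eps0; have [e1 [e10 e1e e11]] := small_margin eps0.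
have [yC [x0 [yC1 x00 hC]]] := GC e10.
pose k := gamma - v * muG.
have k0 : 0 < k by rewrite subr_gt0.
pose A := 2 * muG * v ^+ 2 + 14 * v.
have A0 : 0 < A by rewrite addr_gt0// ?mulr_gt0// ?exprn_gt0.
have yC0 : 0 < yC by rewrite (lt_trans _ yC1).
have yCV : 0 < 1 - yC^-1 by rewrite subr_gt0 invf_lt1.
(* the first bound controls the number of claims, the second one the level *)
pose dl := Num.min (muH * e1 / 4) ((1 - yC^-1) * k / (2 * A)).
have dl0 : 0 < dl.
  by rewrite lt_min; apply/andP; split; apply: divr_gt0; rewrite ?mulr_gt0//.
have dl1 : dl <= muH * e1 / 4 by rewrite ge_min lexx.
have dl2 : 2 * A * dl <= (1 - yC^-1) * k.
  by rewrite mulrC -ler_pdivlMr ?mulr_gt0// ge_min lexx orbT.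
have dlv : dl * v <= e1 / 4.
  rewrite -(ler_pM2r v0) in dl1; apply: (le_trans dl1).
  by rewrite mulrAC [_ * e1 * v]mulrAC muHv mul1r.
have [eY eYneg hY] := sum_gt_upper YG Yenod G0 Gmu g_le GC g_cvg0 GG dl0.
have eZneg := sum_le_negligible ZH Zenod H0 Hmu g_le GC dl0.
have Gam0 : 0 < Gamma by rewrite (lt_trans _ Gamma_gt)// (lt_trans _ gamma_gt)// mulr_gt0.
have ve0 : 0 < e1 * v by rewrite mulr_gt0.
have v20 : 0 < 2 * v by rewrite mulr_gt0.
have hYt := negligible_to_time g_le GC eYneg v0 v20 Gam0 ve0.
have hZt := negligible_to_time g_le GC eZneg v0 v20 Gam0 ve0.
near=> t => x xl xu.
have t0 : 0 < t by near: t; apply: nbhs_pinfty_gt; exact: num_real.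
have t1 : (muG + 7 * dl) / (dl * A) <= t by near: t; apply: nbhs_pinfty_ge; exact: num_real.
have t2 : yC * x0 / k <= t by near: t; apply: nbhs_pinfty_ge; exact: num_real.
have t3 : 2 / (e1 * v) <= t by near: t; apply: nbhs_pinfty_ge; exact: num_real.
have hYn : forall n y, v * t <= n%:R -> n%:R <= 2 * v * t -> y <= Gamma * t ->
    eY n <= e1 * v * (t * g y) by near: t; exact: hYt.
have hZn : forall n y, v * t <= n%:R -> n%:R <= 2 * v * t -> y <= Gamma * t ->
    pr P [set w | \sum_(i < n) Z i w <= n%:R * (muH - dl)] <= e1 * v * (t * g y).
  by near: t; exact: hZt.
rewrite ler_pdivrMr ?mulr_gt0// in t1.
rewrite ler_pdivrMr// in t2.
rewrite ler_pdivrMr// in t3.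
have e1_le1 : e1 <= 1 by lra.
have [n [n_gt f2 f1 f3]] := index_above muHv v0 dl0 dlv e1_le1 t0 t3.
have tv0 : 0 < v * t by rewrite mulr_gt0.
have f4 : n%:R <= 2 * v * t.
  apply: (le_trans f3); rewrite -mulrA ler_pM2r//; lra.
pose y := x - muG * v * t.
have mvt : 0 < muG * v * t by rewrite !mulr_gt0.
have ky : k * t <= y by rewrite /y /k; lra.
have yG : y <= Gamma * t by rewrite /y; lra.
have y0 : 0 < y by apply: lt_le_trans ky; rewrite mulr_gt0.
have y1 : y / yC <= x - n%:R * muG - n%:R * (7 * dl).
  exact: level_above (ltW muG_gt0) dl0 (ltW t0) (ltW yCV) f1 f4 t1 dl2 ky.
have yx0 : x0 <= y / yC.
  by rewrite ler_pdivlMr// mulrC (le_trans t2)// mulrC.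
have gy : g (x - n%:R * muG - n%:R * (7 * dl)) <= (1 + e1) * g y.
  apply: (le_trans (g_le y1)); have [_] := hC _ yx0.
  by rewrite mulfVK// gt_eqF.
apply: (le_trans (ruin_prob_le YG G0 ZH H0 n t x (ltW c0))).
have hZp : pr P [set w | \sum_(i < n) Z i w <= t] <= e1 * v * (t * g y).
  apply: le_trans (hZn n y f2 f4 yG); apply: le_pr.
  - by apply: measurable_le_RV; exact: measurable_sumRV.
  - by apply: measurable_le_RV; exact: measurable_sumRV.
  - by move=> w /= /le_trans; apply.
have hYp : pr P [set w | x < \sum_(i < n) Y i w] <=
    n%:R * ((1 + e1) * g y) + e1 * v * (t * g y).
  have hx : n%:R * (7 * dl) <= x - n%:R * muG.
    by rewrite -subr_ge0; apply: le_trans y1; rewrite divr_ge0// ltW.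
  have := hY n (x - n%:R * muG) hx; rewrite addrC subrK => /le_trans; apply.
  by apply: lerD; [rewrite ler_wpM2l|exact: hYn].
rewrite -/y; apply: (combine_above (ltW e10) e1e e11 (ltW tv0) (ltW (g0 y)) f3).
  by move: hZp; rewrite !mulrA.
by move: hYp; rewrite !mulrA.
Unshelve. all: by end_near. Qed.

(** Here the whole premium income up to time [t] is charged. *)
Lemma ruin_prob_lower eps : 0 < eps -> \forall t \near +oo, forall x,
  gamma * t <= x -> x <= Gamma * t ->
  (1 - eps) * (v * t * g (x - muG * v * t + c * t)) <= ruin_prob Y Z c x t.
Proof.
move=> eps0; have [e1 [e10 e1e e11]] := small_margin eps0.
have [yC [x0 [yC1 x00 hC]]] := GC e10.
pose k := gamma - v * muG + c.
have k0 : 0 < k by rewrite addr_gt0// subr_gt0.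
pose A := muG * v ^+ 2 + v.
have A0 : 0 < A by rewrite addr_gt0// mulr_gt0// exprn_gt0.
(* the first bound controls the number of claims, the second one the level *)
pose dl := Num.min (muH * e1 / 2) ((yC - 1) * k / (2 * A)).
have dl0 : 0 < dl.
  by rewrite lt_min; apply/andP; split; apply: divr_gt0; rewrite ?mulr_gt0 ?subr_gt0//.
have dl1 : dl <= muH * e1 / 2 by rewrite ge_min lexx.
have dl2 : 2 * A * dl <= (yC - 1) * k.
  by rewrite mulrC -ler_pdivlMr ?mulr_gt0// ge_min lexx orbT.
have dlv : dl * v <= e1 / 2.
  rewrite -(ler_pM2r v0) in dl1; apply: (le_trans dl1).
  by rewrite mulrAC [_ * e1 * v]mulrAC muHv mul1r.
have [eY eYneg [B B0 hY]] := sum_gt_lower YG Yenod G0 Gmu g_le GC dl0.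
have eZneg := sum_gt_negligible ZH Zenod H0 Hmu g_le GC g_cvg0 HG1 dl0 HG.
have Gam0 : 0 < Gamma + c.
  by rewrite addr_gt0// (lt_trans _ Gamma_gt)// (lt_trans _ gamma_gt)// mulr_gt0.
have ve0 : 0 < e1 * v by rewrite mulr_gt0.
have v20 : 0 < v / 2 by rewrite divr_gt0.
have MG0 := enod_gt0 Yenod.
have hYt := negligible_to_time g_le GC eYneg v20 v0 Gam0 ve0.
have hZt := negligible_to_time g_le GC eZneg v20 v0 Gam0 ve0.
have kh0 : 0 < k * muH by rewrite mulr_gt0.
have [N _ hN] := g_cvg0 kh0 (divr_gt0 e10 MG0).
near=> t => x xl xu.
have t0 : 0 < t by near: t; apply: nbhs_pinfty_gt; exact: num_real.
have t1 : (muG + B) / (dl * A) <= t by near: t; apply: nbhs_pinfty_ge; exact: num_real.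
have t2 : x0 / k <= t by near: t; apply: nbhs_pinfty_ge; exact: num_real.
have t3 : 2 / (e1 * v) <= t by near: t; apply: nbhs_pinfty_ge; exact: num_real.
have t4 : N.+1%:R / (v / 2) <= t by near: t; apply: nbhs_pinfty_ge; exact: num_real.
have hYn : forall n y, v / 2 * t <= n%:R -> n%:R <= v * t ->
    y <= (Gamma + c) * t -> eY n <= e1 * v * (t * g y) by near: t; exact: hYt.
have hZn : forall n y, v / 2 * t <= n%:R -> n%:R <= v * t ->
    y <= (Gamma + c) * t ->
    pr P [set w | n%:R * (muH + dl) < \sum_(i < n) Z i w] <= e1 * v * (t * g y).
  by near: t; exact: hZt.
rewrite ler_pdivrMr ?mulr_gt0// in t1.
rewrite ler_pdivrMr// in t2.
rewrite ler_pdivrMr// in t3.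
rewrite ler_pdivrMr// in t4.
have [n [n_le f2 f1 f3]] := index_below muHv v0 dl0 dlv t0 t3.
have tv0 : 0 < v * t by rewrite mulr_gt0.
have f4 : v / 2 * t <= n%:R.
  apply: le_trans f3; rewrite mulrAC mulrC ler_pM2r//; lra.
have Nn : (N < n)%N.
  by rewrite -(ler_nat R); apply: le_trans f4; rewrite mulrC.
have n0 : (0 < n)%N by exact: leq_ltn_trans Nn.
pose y := x - muG * v * t + c * t.
have mvt : 0 < muG * v * t by rewrite !mulr_gt0.
have ky : k * t <= y by rewrite /y /k; lra.
have yG : y <= (Gamma + c) * t by rewrite /y; lra.
have y0 : 0 < y by apply: lt_le_trans ky; rewrite mulr_gt0.
pose y1 := x + c * t - n%:R * muG + n%:R * dl + B.
pose s := g y1.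
have yE : y = x + c * t - muG * v * t by rewrite /y; ring.
have y1le : y1 <= y * yC.
  rewrite yE in ky *.
  by apply: level_below (ltW muG_gt0) dl0 (ltW t0) _ f1 f2 t1 dl2 ky;
     rewrite subr_ge0 ltW.
have y1ge : n%:R * (k * muH) <= y1.
  have h1 : n%:R * (k * muH) <= k * t.
    rewrite mulrCA ler_pM2l//; apply: le_trans n_le.
    by rewrite ler_wpM2l// lerDl ltW.
  have h2 : n%:R * muG <= v * t * muG by rewrite ler_wpM2r// ltW.
  have h3 : 0 <= n%:R * dl by rewrite mulr_ge0// ltW.
  move: ky; rewrite /y1 /y; move: h1 h2 h3 B0; lra.
have s0 : 0 < s by exact: g0.
have sy : g y <= (1 + e1) * s.
  have yx0 : x0 <= y by apply: le_trans ky; rewrite mulrC.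
  have [_ h1] := hC _ yx0; apply: (le_trans h1).
  by rewrite ler_pM2l ?addr_gt0// g_le.
have ns : n%:R * s <= e1 / MG.
  apply: le_trans (hN n (ltnW Nn)); rewrite ler_wpM2l//; exact: g_le.
have ns2 : n%:R ^+ 2 * (MG * s ^+ 2) <= e1 * (n%:R * s).
  have -> : n%:R ^+ 2 * (MG * s ^+ 2) = (n%:R * s * MG) * (n%:R * s) by ring.
  by rewrite ler_wpM2r ?mulr_ge0 ?(ltW s0)// -ler_pdivlMr.
apply: le_trans (ruin_prob_ge YG G0 ZH H0 t x n0 (ltW c0)).
have hZp : pr P [set w | t < \sum_(i < n) Z i w] <= e1 * v * (t * g y).
  apply: le_trans (hZn n y f4 f2 yG); apply: le_pr.
  - by apply: measurable_lt_RV; exact: measurable_sumRV.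
  - by apply: measurable_lt_RV; exact: measurable_sumRV.
  - by move=> w /=; exact: le_lt_trans.
have hYp : n%:R * s - n%:R ^+ 2 * (MG * s ^+ 2) - eY n <=
    pr P [set w | x + c * t < \sum_(i < n) Y i w].
  have -> : x + c * t = n%:R * muG + (x + c * t - n%:R * muG) by ring.
  exact: hY.
have eYn := hYn n y f4 f2 yG.
rewrite -/y; apply: (combine_below (ltW e10) e1e e11 (ltW tv0) (ltW (g0 y))
  (ltW s0) f3 sy ns2 _ _ hYp).
  by move: eYn; rewrite !mulrA.
by move: hZp; rewrite !mulrA.
Unshelve. all: by end_near. Qed.

End ruin_asymptotics.

(** * Limits inferior and the theorem *)

Section limf.
Context {T : choiceType} {X : filteredType T} {R : realType}.
Implicit Types (f : X -> \bar R) (F : set_system X).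

Lemma limf_einf_gt f F a : Filter F -> (a < limf_einf f F)%E ->
  \forall x \near F, (a < f x)%E.
Proof.
move=> FF; rewrite limf_einfE => /ereal_sup_gt[_ [V FV <-] aV].
apply: filterS FV => x Vx; apply: (lt_le_trans aV).
by apply: ereal_inf_lbound; exists x.
Qed.

Lemma limf_einf_ge f F a : (\forall x \near F, (a <= f x)%E) ->
  (a <= limf_einf f F)%E.
Proof.
move=> h; rewrite limf_einfE; apply: le_ereal_sup_tmp.
exists (ereal_inf (f @` [set x | (a <= f x)%E])); first by exists [set x | (a <= f x)%E].
by apply: le_ereal_inf_tmp => _ [x hx <-].
Qed.

Lemma limf_esup_le f F a : (\forall x \near F, (f x <= a)%E) ->
  (limf_esup f F <= a)%E.
Proof.
move=> h; rewrite limf_esupE; apply: ge_ereal_inf.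
exists (ereal_sup (f @` [set x | (f x <= a)%E])); first by exists [set x | (f x <= a)%E].
by apply: ge_ereal_sup => _ [x hx <-].
Qed.

Lemma limf_einf_le_esup f1 f2 F : ProperFilter F ->
  (\forall x \near F, (f1 x <= f2 x)%E) -> (limf_einf f1 F <= limf_esup f2 F)%E.
Proof.
move=> FF h; rewrite limf_einfE limf_esupE; apply: ge_ereal_sup => _ [V FV <-].
apply: le_ereal_inf_tmp => _ [W FW <-].
have [x [[Vx Wx] /= fx]] := filter_ex (filterI (filterI FV FW) h).
apply: (@le_trans _ _ (f1 x)); first by apply: ereal_inf_lbound; exists x.
by apply: (le_trans fx); apply: ereal_sup_ubound; exists x.
Qed.

End limf.

Section tail_hypotheses.
Context {R : realType}.
Variable G : probability R R.

Lemma tail_liminf_gt (y a : R) : (a%:E < tail_liminf G y)%E ->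
  \forall x \near +oo, a < survival G (x * y) / survival G x.
Proof. by move=> /limf_einf_gt h; apply: filterS h => x; rewrite lte_fin. Qed.

(** A lower bound [1 / (1 + eps)] on the quotient near infinity also yields
positivity, since the quotient is [0] where the tail vanishes. *)
Lemma consistently_varyingP : consistently_varying G -> consistent (survival G).
Proof.
move=> GC eps eps0.
have a1 : (((1 + eps)^-1)%:E < 1 :> \bar R)%E.
  by rewrite lte_fin invf_lt1 ?ltrDl// addr_gt0.
have h : \forall y \near 1^'+, (((1 + eps)^-1)%:E < tail_liminf G y)%E.
  exact: (GC [set z | (((1 + eps)^-1)%:E < z)%E] (open_ereal_gt' a1)).
have h1 : \forall y \near (1:R)^'+, 1 < y by exact: nbhs_right_gt.
have [y hy1] := @filter_ex _ _ (at_right_proper_filter (1 : R)) _ (filterI h h1); have [hy y1] := hy1.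
have [x0 [_ hx0]] := tail_liminf_gt hy.
exists y, (Num.max (x0 + 1) 1); split; [exact: y1|by rewrite lt_max ltr01 orbT|].
move=> x; rewrite ge_max => /andP[xx0 x1].
have := hx0 x ltac:(by rewrite (lt_le_trans _ xx0)// ltrDl).
have e10 : 0 < 1 + eps by rewrite addr_gt0.
have [s0|s0] := eqVneq (survival G x) 0.
  by rewrite s0 invr0 mulr0 ltNge invr_ge0 ltW.
have {}s0 : 0 < survival G x by rewrite lt_neqAle eq_sym s0 survival_ge0.
rewrite ltr_pdivlMr// ltr_pdivrMl// => /ltW.
by [].
Qed.

Lemma tail_littleoP (H : probability R R) : tail H =o_pinfty_filter tail G ->
  forall eps, 0 < eps -> exists x1, forall x, x1 <= x ->
    survival H x <= eps * survival G x.
Proof.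
move=> /eqoP HG eps eps0; have [x0 [_ h]] := HG _ eps0.
exists (x0 + 1) => x xx0.
have : `|tail H x| <= eps * `|tail G x| by apply: h; rewrite (lt_le_trans _ xx0)// ltrDl.
by rewrite !ger0_norm//; [exact: survival_ge0|exact: survival_ge0].
Qed.

(** The lower bound comes from comparability, the upper one from monotonicity. *)
Lemma tail_liminf_fin (y : R) : consistent (survival G) -> 1 <= y ->
  exists2 a : R, 0 < a & tail_liminf G y = a%:E.
Proof.
move=> GC y1; have g0 := consistent_gt0 (@survival_le _ G) GC.
have y0 : 0 < y by exact: lt_le_trans y1.
have [C [t0 [C0 t00 hC]]] := consistent_comparable (@survival_le _ G) GC ltr01 y0.
have lo : ((C^-1)%:E <= tail_liminf G y)%E.
  apply: limf_einf_ge; near=> x; rewrite lee_fin.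
  rewrite -/(survival G _) -/(survival G _) ler_pdivlMr// ler_pdivrMl//.
  rewrite -[x in survival G x <= _]mul1r [x * y]mulrC; apply: hC.
  by near: x; apply: nbhs_pinfty_ge; exact: num_real.
have up : (tail_liminf G y <= 1%:E)%E.
  rewrite leNgt; apply/negP => /tail_liminf_gt [x0 [_ h]].
  pose x := Num.max (x0 + 1) 0.
  have := h x ltac:(by rewrite lt_max ltrDl ltr01).
  rewrite ltNge ler_pdivrMr// mul1r => /negP; apply; apply: survival_le.
  by rewrite ler_peMr// le_max lexx orbT.
case: (tail_liminf G y) lo up => [a|//|//]; rewrite lee_fin => Ca _.
by exists a => //; apply: lt_le_trans Ca; rewrite invr_gt0.
Unshelve. all: by end_near. Qed.

End tail_hypotheses.

Theorem theorem1p2 (d : measure_display) (T : measurableType d) (R : realType)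
    (P : probability T R) (Y Z : nat -> {RV P >-> R}) (tau : {RV P >-> R})
    (G H : probability R R) (muG muH c MG MH : R)
    (hYG : forall i, has_law (Y i) G) (hG0 : nonneg_law G)
    (hmuG : has_mean G muG) (muG_gt0 : 0 < muG)
    (hZH : forall i, has_law (Z i) H) (hH0 : nonneg_law H)
    (hmuH : has_mean H muH) (muH_gt0 : 0 < muH)
    (htau : P [set w | tau w < 0] = 0%E)
    (hlambda : ereal_inf [set t%:E | t in
        [set t : R | 0 <= t /\ (0 < renewal_fun Z t < +oo)%E]] = 0%E)
    (c_gt0 : 0 < c) (hsafety : muG < c * muH)
    (hindep : independent_of_pairs Y Z tau)
    (hYenod : enod Y MG) (hGC : consistently_varying G)
    (hZenod : enod Z MH) (hHG : tail H =o_pinfty_filter tail G)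
    (gamma Gamma : R) (hgamma : Num.max muG (muH^-1 * muG) < gamma)
    (hGamma : gamma < Gamma) :
  let ratio (t x : R) : \bar R :=
    (ruin_prob Y Z c x t /
      (muH^-1 * t * tail G (x - muG * muH^-1 * t + c * t)))%:E in
  let lower : \bar R :=
    limf_einf (fun t : R =>
      ereal_inf [set ratio t x | x in `[gamma * t, Gamma * t]]) +oo%R in
  let upper : \bar R :=
    limf_esup (fun t : R =>
      ereal_sup [set ratio t x | x in `[gamma * t, Gamma * t]]) +oo%R in
  let dG : \bar R := tail_liminf G (1 + c / (gamma - muH^-1 * muG)) in
  [/\ (1 <= lower)%E, (lower <= upper)%E & (upper <= dG^-1)%E].
Proof.
have GC := consistently_varyingP hGC.
have g_le := @survival_le _ G; have g0 := consistent_gt0 g_le GC.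
have HG := tail_littleoP hHG.
have gamma_gt : muH^-1 * muG < gamma.
  by apply: le_lt_trans hgamma; rewrite le_max lexx orbT.
set v := muH^-1; have v0 : 0 < v by rewrite invr_gt0.
pose k := gamma - v * muG.
have k0 : 0 < k by rewrite subr_gt0.
pose y t x := x - muG * v * t.
have y_ge t x : gamma * t <= x -> k * t <= y t x by rewrite /y /k; lra.
move=> ratio lower upper dG; split.
- apply/lee_subgt0Pr => eps eps0; apply: limf_einf_ge.
  have lowb := ruin_prob_lower hYG hG0 hmuG muG_gt0 hZH hH0 hmuH muH_gt0 c_gt0
    hYenod hZenod GC HG gamma_gt hGamma eps0.
  near=> t; have t0 : 0 < t by near: t; apply: nbhs_pinfty_gt; exact: num_real.
  have lowt : forall x, gamma * t <= x -> x <= Gamma * t ->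
      (1 - eps) * (v * t * survival G (x - muG * v * t + c * t)) <=
      ruin_prob Y Z c x t by near: t; exact: lowb.
  apply: le_ereal_inf_tmp => _ [x + <-]; rewrite /= in_itv/= => /andP[xl xu].
  rewrite -EFinB lee_fin ler_pdivlMr; first exact: lowt.
  by apply: mulr_gt0; [exact: mulr_gt0|exact: g0].
- apply: limf_einf_le_esup; near=> t.
  have t0 : 0 < t by near: t; apply: nbhs_pinfty_gt; exact: num_real.
  apply: (@le_trans _ _ (ratio t (gamma * t))).
    apply: ereal_inf_lbound; exists (gamma * t) => //.
    by rewrite /= in_itv/= lexx ler_pM2r// ltW.
  apply: ereal_sup_ubound; exists (gamma * t) => //.
  by rewrite /= in_itv/= lexx ler_pM2r// ltW.
have Ystar1 : 1 <= 1 + c / k by rewrite lerDl divr_ge0// ltW.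
have [a a0 dGa] := tail_liminf_fin GC Ystar1.
rewrite /dG -/v -/k dGa inver gt_eqF//.
apply/lee_addgt0Pr => eps eps0; apply: limf_esup_le.
(* dl solves (1 + dl) / (a - dl) = 1 / a + eps *)
pose dl := eps * a / (1 + a^-1 + eps).
have den0 : 0 < 1 + a^-1 + eps by rewrite !addr_gt0// invr_gt0.
have dl0 : 0 < dl by rewrite divr_gt0// mulr_gt0.
have dlE : (1 + dl) = (a^-1 + eps) * (a - dl).
  have dlD : dl * (1 + a^-1 + eps) = eps * a by rewrite /dl divfK// gt_eqF.
  have aV : a^-1 * a = 1 by rewrite mulVf// gt_eqF.
  by rewrite mulrBr mulrDl aV; lra.
have dla : 0 < a - dl.
  rewrite subr_gt0 /dl ltr_pdivrMr// mulrC ltr_pM2l//.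
  by rewrite ltrDr addr_gt0// invr_gt0.
have uppb := ruin_prob_upper hYG hG0 hmuG muG_gt0 hZH hH0 hmuH muH_gt0 c_gt0
  hYenod hZenod GC gamma_gt hGamma dl0.
have [x0 [_ hx0]] : \forall x \near +oo,
    a - dl < survival G (x * (1 + c / k)) / survival G x.
  by apply: tail_liminf_gt; rewrite dGa lte_fin gtrBl.
near=> t; have t0 : 0 < t by near: t; apply: nbhs_pinfty_gt; exact: num_real.
have tx0 : x0 / k < t by near: t; apply: nbhs_pinfty_gt; exact: num_real.
have uppt : forall x, gamma * t <= x -> x <= Gamma * t ->
    ruin_prob Y Z c x t <= (1 + dl) * (v * t * survival G (x - muG * v * t)).
  by near: t; exact: uppb.
apply: ge_ereal_sup => _ [x + <-]; rewrite /= in_itv/= => /andP[xl xu].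
have vt0 : 0 < v * t by rewrite mulr_gt0.
have den : 0 < v * t * survival G (y t x + c * t) by rewrite mulr_gt0.
rewrite -EFinD lee_fin ler_pdivrMr//; apply: (le_trans (uppt x xl xu)).
have ky := y_ge t x xl.
have := hx0 (y t x) ltac:(by apply: lt_le_trans ky; rewrite mulrC -ltr_pdivrMr).
rewrite ltr_pdivlMr// => hy.
have hy2 : survival G (y t x * (1 + c / k)) <= survival G (y t x + c * t).
  apply: g_le; rewrite mulrDr mulr1 lerD2l mulrCA ler_pM2l//.
  by rewrite ler_pdivlMr// mulrC.
rewrite dlE -[leLHS]mulrA ler_pM2l ?addr_gt0 ?invr_gt0//.
rewrite mulrCA ler_pM2l//; apply: le_trans hy2; exact: ltW.
Unshelve. all: by end_near. Qed.
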